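(* Let $K$ be a bounded right linear operator with closed range on a separable right quaternionic Hilbert space $\mathbb{H}(\mathfrak{H})$, and let $\{f_k\}_{k\in I}$ be a $K$-frame for $\mathbb{H}(\mathfrak{H})$ with synthesis operator $T_F$ and frame operator $S_F$. Let $\{e_k\}_{k\in I}$ be the standard orthonormal basis of $\ell^2(\mathfrak{H})$. Then a sequence $\{g_k\}_{k\in I}$ in $\mathbb{H}(\mathfrak{H})$ is a $K$-dual of $\{P_{R(K)}f_k\}_{k\in I}$ if and only if there exists a bounded right linear operator $M:\mathbb{H}(\mathfrak{H})\to\ell^2(\mathfrak{H})$ such that $P_{R(K)}T_FM=0$ and $$g_k=K^*S_F^{-1}P_{S_F(R(K))}f_k+M^*e_k,\qquad k\in I.$$
   Context: $\mathfrak{H}$ denotes the quaternions. A right quaternionic Hilbert space $\mathbb{H}(\mathfrak{H})$ is a right $\mathfrak{H}$-vector space with an inner product $\langle\cdot,\cdot\rangle$ valued in $\mathfrak{H}$ that satisfies $\overline{\langle x,y\rangle}=\langle y,x\rangle$, $\langle x,x\rangle>0$ for $x\neq0$, additivity in the second argument, and $\langle x,yq\rangle=\langle x,y\rangle q$ for $q\in\mathfrak{H}$, and it is complete for $\|x\|=\sqrt{\langle x,x\rangle}$. $I$ is a countable index set. $\ell^2(\mathfrak{H})$ is the right quaternionic Hilbert space of square-summable families $\{q_k\}_{k\in I}\subset\mathfrak{H}$ with $\langle p,q\rangle=\sum_{k}\overline{p_k}q_k$. All operators are bounded and right linear ($T(xp+yq)=T(x)p+T(y)q$), and $T^*$ is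 the adjoint. A family $\{f_k\}_{k\in I}\subset\mathbb{H}(\mathfrak{H})$ is a Bessel sequence if there is $B>0$ with $\sum_{k}|\langle x,f_k\rangle|^2\le B\|x\|^2$ for all $x$. It is a $K$-frame if there are $A,B>0$ with $A\|K^*x\|^2\le\sum_{k}|\langle x,f_k\rangle|^2\le B\|x\|^2$ for all $x$. A Bessel sequence $\{g_k\}_{k\in I}$ is a $K$-dual of a $K$-frame $\{f_k\}_{k\in I}$ if $Kx=\sum_{k\in I}f_k\langle g_k,x\rangle$ for all $x\in\mathbb{H}(\mathfrak{H})$. The synthesis operator of a Bessel sequence $F=\{f_k\}$ is $T_F:\ell^2(\mathfrak{H})\to\mathbb{H}(\mathfrak{H})$, $T_F(\{c_k\})=\sum_kf_kc_k$, with adjoint $T_F^*x=\{\langle f_k,x\rangle\}_{k}$. The frame operator is $S_F=T_FT_F^*$. $R(K)$ is the range of $K$, and $P_M$ is the orthogonal projection onto a closed subspace $M$. When $R(K)$ is closed and $\{f_k\}$ is a $K$-frame, the restriction $S_F:R(K)\to S_F(R(K))$ is invertible and $S_F(R(K))$ is closed. $S_F^{-1}:S_F(R(K))\to R(K)$ denotes the inverse of this restriction. *)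

(* Defs.v *)
From HB Require Import structures.
From mathcomp Require Import all_boot all_order all_algebra finmap ring lra.
From mathcomp Require Import all_classical all_reals all_analysis.
From mathcomp.analysis.showcase Require summability.

Set Implicit Arguments.
Unset Strict Implicit.
Unset Printing Implicit Defensive.

Import Order.TTheory GRing.Theory Num.Theory.
Import numFieldNormedType.Exports.

Local Open Scope classical_set_scope.
Local Open Scope ring_scope.

Record quat (R : Type) := Quat { qre : R; qi : R; qj : R; qk : R }.

Section quat_choice.
Context {R : Type}.

Definition quat_to_tuple (q : quat R) := (qre q, qi q, qj q, qk q).
Definition quat_of_tuple (t : R * R * R * R) :=
  Quat t.1.1.1 t.1.1.2 t.1.2 t.2.

Lemma quat_to_tupleK : cancel quat_to_tuple quat_of_tuple.
Proof. by case. Qed.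

Lemma quatP (p q : quat R) :
  qre p = qre q -> qi p = qi q -> qj p = qj q -> qk p = qk q -> p = q.
Proof. by case: p q => [????] [????] /= -> -> -> ->. Qed.
End quat_choice.

HB.instance Definition _ (R : choiceType) :=
  Choice.copy (quat R) (can_type (@quat_to_tupleK R)).

Section quat_ring.
Context {R : comNzRingType}.
Implicit Types p q : quat R.

Definition quat_zero : quat R := Quat 0 0 0 0.
Definition quat_one : quat R := Quat 1 0 0 0.
Definition quat_opp p := Quat (- qre p) (- qi p) (- qj p) (- qk p).
Definition quat_add p q :=
  Quat (qre p + qre q) (qi p + qi q) (qj p + qj q) (qk p + qk q).
Definition quat_mul p q := Quat
  (qre p * qre q - qi p * qi q - qj p * qj q - qk p * qk q)
  (qre p * qi q + qi p * qre q + qj p * qk q - qk p * qj q)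
  (qre p * qj q - qi p * qk q + qj p * qre q + qk p * qi q)
  (qre p * qk q + qi p * qj q - qj p * qi q + qk p * qre q).

Fact quat_addA : associative quat_add.
Proof. by move=> p q r; apply: quatP; rewrite /= addrA. Qed.
Fact quat_addC : commutative quat_add.
Proof. by move=> p q; apply: quatP; rewrite /= addrC. Qed.
Fact quat_add0 : left_id quat_zero quat_add.
Proof. by move=> p; apply: quatP; rewrite /= add0r. Qed.
Fact quat_addN : left_inverse quat_zero quat_opp quat_add.
Proof. by move=> p; apply: quatP; rewrite /= addNr. Qed.

HB.instance Definition _ :=
  GRing.isZmodule.Build (quat R) quat_addA quat_addC quat_add0 quat_addN.

Fact quat_mulA : associative quat_mul.
Proof. by move=> p q r; apply: quatP => /=; ring. Qed.
Fact quat_mul1l : left_id quat_one quat_mul.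
Proof. by move=> p; apply: quatP => /=; ring. Qed.
Fact quat_mul1r : right_id quat_one quat_mul.
Proof. by move=> p; apply: quatP => /=; ring. Qed.
Fact quat_mulDl : left_distributive quat_mul +%R.
Proof. by move=> p q r; apply: quatP => /=; ring. Qed.
Fact quat_mulDr : right_distributive quat_mul +%R.
Proof. by move=> p q r; apply: quatP => /=; ring. Qed.
Fact quat_one_neq0 : quat_one != 0.
Proof. by apply/eqP => /(congr1 (@qre R))/= /eqP; rewrite oner_eq0. Qed.

HB.instance Definition _ := GRing.Zmodule_isNzRing.Build (quat R)
  quat_mulA quat_mul1l quat_mul1r quat_mulDl quat_mulDr quat_one_neq0.

Definition quat_conj p := Quat (qre p) (- qi p) (- qj p) (- qk p).

End quat_ring.

(* A separate structure rather than lmodType (quat R)^c: Hierarchy Builder has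
   no join of left modules over a converse ring with the topological structures
   below, whose modules are over a numDomainType. *)
HB.mixin Record Zmodule_isRightModule (S : pzRingType) V & GRing.Zmodule V := {
  rscale : V -> S -> V;
  rscalerA : forall x p q, rscale x (p * q) = rscale (rscale x p) q;
  rscaler1 : forall x, rscale x 1 = x;
  rscalerDl : forall x y p, rscale (x + y) p = rscale x p + rscale y p;
  rscalerDr : forall x p q, rscale x (p + q) = rscale x p + rscale x q
}.

#[short(type="rightModType")]
HB.structure Definition RightModule (S : pzRingType) :=
  {V of GRing.Zmodule V & Zmodule_isRightModule S V}.

Notation "x :* q" := (rscale x q) : ring_scope.

HB.mixin Record isQInnerProduct (R : realType) V
    & PseudoMetricNormedZmod R V & RightModule (quat R) V := {
  qdot : V -> V -> quat R;
  qdot_conj : forall x y, quat_conj (qdot x y) = qdot y x;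
  qdot_gt0 : forall x, x != 0 -> 0 < qre (qdot x x);
  qdotDr : forall x y z, qdot x (y + z) = qdot x y + qdot x z;
  qdotZr : forall x y q, qdot x (y :* q) = qdot x y * q;
  norm_qdot : forall x, `|x| = Num.sqrt (qre (qdot x x))
}.

#[short(type="qpreHilbertType")]
HB.structure Definition QPreHilbert (R : realType) :=
  {V of PseudoMetricNormedZmod R V & RightModule (quat R) V
   & isQInnerProduct R V}.

(* The axiom of Complete, which cannot be reused here: every structure joining
   Complete with an additive group would have to precede CompleteNormedModule. *)
HB.mixin Record QPreHilbert_isComplete (R : realType) V & QPreHilbert R V := {
  qcauchy_cvg : forall F : set_system V, ProperFilter F -> cauchy F -> cvg F
}.

#[short(type="qhilbertType")]
HB.structure Definition QHilbert (R : realType) :=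
  {V of QPreHilbert R V & QPreHilbert_isComplete R V}.

HB.factory Record RightModule_isQPreHilbert (R : realType) V
    & RightModule (quat R) V := {
  qdot : V -> V -> quat R;
  qdot_conj : forall x y, quat_conj (qdot x y) = qdot y x;
  qdot_gt0 : forall x, x != 0 -> 0 < qre (qdot x x);
  qdotDr : forall x y z, qdot x (y + z) = qdot x y + qdot x z;
  qdotZr : forall x y q, qdot x (y :* q) = qdot x y * q
}.

HB.builders Context R V & RightModule_isQPreHilbert R V.

Let norm x := Num.sqrt (qre (qdot x x)).
Let dot x y := qre (qdot x y).

Let dotC x y : dot x y = dot y x.
Proof. by rewrite /dot -qdot_conj. Qed.

Let dotDr x y z : dot x (y + z) = dot x y + dot x z.
Proof. by rewrite /dot qdotDr. Qed.

Let dotDl x y z : dot (x + y) z = dot x z + dot y z.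
Proof. by rewrite dotC dotDr !(dotC z). Qed.

Let dotZr x y (t : R) : dot x (y :* Quat t 0 0 0) = t * dot x y.
Proof. by rewrite /dot qdotZr /=; ring. Qed.

Let dotZl x y (t : R) : dot (x :* Quat t 0 0 0) y = t * dot x y.
Proof. by rewrite dotC dotZr dotC. Qed.

Let dot0r x : dot x 0 = 0.
Proof. by apply: (addrI (dot x 0)); rewrite -dotDr !addr0. Qed.

Let dot_gt0 x : x != 0 -> 0 < dot x x. Proof. exact: qdot_gt0. Qed.

Let dot_ge0 x : 0 <= dot x x.
Proof.
have [->|/dot_gt0/ltW//] := eqVneq x 0.
by rewrite dot0r.
Qed.

Let dotN x : dot (- x) (- x) = dot x x.
Proof.
have dotxN y : dot y (- x) = - dot y x.
  by apply: (addrI (dot y x)); rewrite -dotDr !subrr dot0r.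
by rewrite dotxN dotC dotxN opprK.
Qed.

Let dotMn x n : dot (x *+ n) (x *+ n) = dot x x *+ n *+ n.
Proof.
have dotxMn y z m : dot y (z *+ m) = dot y z *+ m.
  by elim: m => [|m IHm]; rewrite ?mulr0n ?dot0r// !mulrS dotDr IHm.
by rewrite dotxMn dotC dotxMn.
Qed.

Let dot_CS x y : dot x y ^+ 2 <= dot x x * dot y y.
Proof.
have [->|/dot_gt0 y0] := eqVneq y 0; first by rewrite !dot0r expr0n mulr0.
set a := dot x x; set b := dot x y; set c := dot y y.
have := dot_ge0 (x :* Quat c 0 0 0 + y :* Quat (- b) 0 0 0).
rewrite dotDr !dotDl !dotZr !dotZl (dotC y x) -/a -/b -/c => h.
rewrite -subr_ge0 -(pmulr_rge0 _ y0) -/c.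
by apply: le_trans h _; rewrite le_eqVlt; apply/orP; left; apply/eqP; ring.
Qed.

Let normE x : norm x ^+ 2 = dot x x. Proof. exact/sqr_sqrtr/dot_ge0. Qed.

Let norm_ge0 x : 0 <= norm x. Proof. exact: sqrtr_ge0. Qed.

Let ler_normD x y : norm (x + y) <= norm x + norm y.
Proof.
rewrite -(@ler_pXn2r _ 2) ?nnegrE ?addr_ge0// normE sqrrD !normE.
rewrite dotDr !dotDl (dotC y x).
suff h : dot x y <= norm x * norm y by rewrite -subr_ge0; nra.
apply: le_trans (ler_norm _) _.
by rewrite -(@ler_pXn2r _ 2) ?nnegrE ?mulr_ge0// exprMn !normE real_normK ?num_real.
Qed.

Let normr0_eq0 x : norm x = 0 -> x = 0.
Proof.
move=> x0; apply/eqP/negP => /negP /dot_gt0.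
by rewrite -normE x0 expr0n ltxx.
Qed.

Let normrMn x n : norm (x *+ n) = norm x *+ n.
Proof.
apply/eqP; rewrite -(@eqrXn2 _ 2) ?mulrn_wge0//.
by rewrite normE dotMn exprMn_n normE -mulrnA mulnn.
Qed.

Let normrN x : norm (- x) = norm x.
Proof. by rewrite /norm -!/(dot _ _) dotN. Qed.

HB.instance Definition _ := Num.Zmodule_isNormed.Build R V
  ler_normD normr0_eq0 normrMn normrN.
HB.instance Definition _ := PseudoMetric.copy V (pseudoMetric_normed V).
HB.instance Definition _ := isPointed.Build V 0.
HB.instance Definition _ := NormedZmod_PseudoMetric_eq.Build R V erefl.
HB.instance Definition _ := isQInnerProduct.Build R V
  qdot_conj qdot_gt0 qdotDr qdotZr (fun=> erefl).
HB.end.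

Section quat_hilbert.
Context {R : realType}.
Implicit Types p q : quat R.

HB.instance Definition _ := Zmodule_isRightModule.Build (quat R) (quat R)
  (@mulrA (quat R)) (@mulr1 (quat R)) (@mulrDl (quat R)) (@mulrDr (quat R)).

Definition quat_dot p q := quat_conj p * q.

Fact quat_dot_conj p q : quat_conj (quat_dot p q) = quat_dot q p.
Proof. by apply: quatP => /=; ring. Qed.

Fact quat_dot_gt0 p : p != 0 -> 0 < qre (quat_dot p p).
Proof.
apply: contraNT; rewrite -leNgt => h; apply/eqP.
case: p h => a b c d /= h.
have {}h : a ^+ 2 + b ^+ 2 + c ^+ 2 + d ^+ 2 <= 0 by lra.
have ge2 (x : R) : 0 <= x ^+ 2 := sqr_ge0 x.
have z2 (x : R) : x ^+ 2 <= 0 -> x = 0.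
  by move=> ?; apply/eqP; rewrite -sqrf_eq0 eq_le ge2 andbT.
by apply: quatP; apply: z2 => /=; move: h (ge2 a) (ge2 b) (ge2 c) (ge2 d); lra.
Qed.

Fact quat_dotDr p q r : quat_dot p (q + r) = quat_dot p q + quat_dot p r.
Proof. exact: mulrDr. Qed.

Fact quat_dotZr p q r : quat_dot p (q :* r) = quat_dot p q * r.
Proof. exact: mulrA. Qed.

HB.instance Definition _ := RightModule_isQPreHilbert.Build R (quat R)
  quat_dot_conj quat_dot_gt0 quat_dotDr quat_dotZr.

Lemma norm_quatE q :
  `|q| = Num.sqrt (qre q ^+ 2 + qi q ^+ 2 + qj q ^+ 2 + qk q ^+ 2).
Proof. by rewrite norm_qdot /=; congr Num.sqrt; ring. Qed.

End quat_hilbert.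

Section quat_norm.
Context {R : realType}.
Implicit Types p q : quat R.

Lemma sqr_norm_quat q :
  `|q| ^+ 2 = qre q ^+ 2 + qi q ^+ 2 + qj q ^+ 2 + qk q ^+ 2.
Proof. by rewrite norm_quatE sqr_sqrtr// !addr_ge0 ?sqr_ge0. Qed.

Lemma norm_quat_conj q : `|quat_conj q| = `|q|.
Proof. by rewrite !norm_quatE /= !sqrrN. Qed.

Lemma norm_quatM p q : `|p * q| = `|p| * `|q|.
Proof.
apply/eqP; rewrite -(@eqrXn2 _ 2) ?mulr_ge0//; apply/eqP.
by rewrite exprMn !sqr_norm_quat /=; ring.
Qed.

Let sqr_le_norm (c : R) q : c ^+ 2 <= `|q| ^+ 2 -> `|c| <= `|q|.
Proof.
by move=> h; rewrite -(@ler_pXn2r _ 2) ?nnegrE// real_normK ?num_real.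
Qed.

Lemma norm_qre q : `|qre q| <= `|q|.
Proof. by apply: sqr_le_norm; rewrite sqr_norm_quat; nra. Qed.
Lemma norm_qi q : `|qi q| <= `|q|.
Proof. by apply: sqr_le_norm; rewrite sqr_norm_quat; nra. Qed.
Lemma norm_qj q : `|qj q| <= `|q|.
Proof. by apply: sqr_le_norm; rewrite sqr_norm_quat; nra. Qed.
Lemma norm_qk q : `|qk q| <= `|q|.
Proof. by apply: sqr_le_norm; rewrite sqr_norm_quat; nra. Qed.

Lemma norm_quat_le q : `|q| <= `|qre q| + `|qi q| + `|qj q| + `|qk q|.
Proof.
rewrite -(@ler_pXn2r _ 2) ?nnegrE ?addr_ge0// sqr_norm_quat.
rewrite -(real_normK (num_real (qre q))) -(real_normK (num_real (qi q))).
rewrite -(real_normK (num_real (qj q))) -(real_normK (num_real (qk q))).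
have := normr_ge0 (qre q); have := normr_ge0 (qi q).
have := normr_ge0 (qj q); have := normr_ge0 (qk q).
by move: `|qre q| `|qi q| `|qj q| `|qk q| => a b c d *; nra.
Qed.

Let cvg_coord (f : quat R -> R) (F : set_system (quat R)) :
  (forall p q, f (p - q) = f p - f q) -> (forall q, `|f q| <= `|q|) ->
  ProperFilter F -> cauchy F -> cvg (f @ F).
Proof.
move=> fB fle FF /cauchyP Fc; apply/cauchy_cvgP/cauchyP => e e0.
have [q Fq] := Fc _ e0; exists (f q).
change (F [set p | `|f q - f p| < e]); apply: filterS Fq => p.
rewrite -ball_normE => pq.
by have := le_lt_trans (fle (q - p)) pq; rewrite fB.
Qed.

Fact quat_complete (F : set_system (quat R)) :
  ProperFilter F -> cauchy F -> cvg F.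
Proof.
move=> FF Fc.
have /cvg_ex[a Fa] : cvg (@qre R @ F).
  by apply: cvg_coord Fc => //; apply: norm_qre.
have /cvg_ex[b Fb] : cvg (@qi R @ F).
  by apply: cvg_coord Fc => //; apply: norm_qi.
have /cvg_ex[c Fc'] : cvg (@qj R @ F).
  by apply: cvg_coord Fc => //; apply: norm_qj.
have /cvg_ex[d Fd] : cvg (@qk R @ F).
  by apply: cvg_coord Fc => //; apply: norm_qk.
apply/cvg_ex; exists (Quat a b c d); apply/fcvgrPdist_lt => e e0.
have e4 : 0 < e / 4 by rewrite divr_gt0.
near=> q; apply: le_lt_trans (norm_quat_le _) _ => /=.
suff [? ? ? ?] : [/\ `|a - qre q| < e / 4, `|b - qi q| < e / 4,
  `|c - qj q| < e / 4 & `|d - qk q| < e / 4] by lra.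
by split; near: q; [move/cvgrPdist_lt: Fa|move/cvgrPdist_lt: Fb|
  move/cvgrPdist_lt: Fc'|move/cvgrPdist_lt: Fd]; apply.
Unshelve. all: by end_near. Qed.

HB.instance Definition _ := QPreHilbert_isComplete.Build R (quat R) quat_complete.

End quat_norm.

(* Since the index set carries no order, sums are unconditional: limits of the
   finite partial sums along the inclusion of finite sets of indices. *)
Definition usum (R : realType) (V : pseudoMetricNormedZmodType R)
    (I : choiceType) (x : I -> V) : V :=
  lim (summability.partial_sum x @ summability.totally).

#[local] Existing Instance summability.totally_filter.

Section usum.
Import summability.
Context {R : realType} {I : choiceType}.

Lemma partial_sumE (V : zmodType) (x : I -> V) (J : {fset I}) :
  partial_sum x J = \sum_(i <- J) x i.
Proof. by rewrite /partial_sum big_seq_fsetE. Qed.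

Lemma near_totally (P : {fset I} -> Prop) (J0 : {fset I}) :
  (forall J, fsubset J0 J -> P J) -> \forall J \near totally, P J.
Proof. by move=> h; exists J0. Qed.

Lemma cvg_usum_map (V W : pseudoMetricNormedZmodType R)
    (f : V -> W) (C : R) (x : I -> V) (v : V) :
  {morph f : u w / u + w} -> (forall u, `|f u| <= C * `|u|) ->
  (partial_sum x @ totally) --> v ->
  (partial_sum (f \o x) @ totally) --> f v.
Proof.
move=> fD fC /cvgrPdist_lt xv; apply/cvgrPdist_lt => e e0.
have f0 : f 0 = 0 by apply: (addrI (f 0)); rewrite -fD !addr0.
have C1 : 0 < `|C| + 1 by rewrite ltr_wpDl.
near=> J; rewrite partial_sumE; pose s := \sum_(i <- J) x i.
rewrite (_ : \sum_(i <- J) _ = f s); last by rewrite (big_morph f fD f0).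
rewrite -{1}(subrK s v) fD addrK.
apply: le_lt_trans (fC _) _; apply: (@le_lt_trans _ _ ((`|C| + 1) * `|v - s|)).
  by rewrite ler_wpM2r// (le_trans (ler_norm _))// lerDl.
rewrite mulrC -ltr_pdivlMr// /s -partial_sumE.
by near: J; apply: xv; rewrite divr_gt0.
Unshelve. all: by end_near. Qed.

Lemma sum_fset_sub (V : zmodType) (x : I -> V) (J0 J : {fset I}) :
  fsubset J0 J ->
  \sum_(i <- J) x i = \sum_(i <- J0) x i + \sum_(i <- fsetD J J0) x i.
Proof.
move=> J0J; rewrite (big_fsetID _ (mem J0)) /=; congr (_ + _);
  apply: eq_fbigl => i; rewrite !inE/=; last by rewrite andbC.
by rewrite andb_idl//; exact/fsubsetP.
Qed.

Lemma usum_cvg (V : qhilbertType R) (x : I -> V) (M : R) :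
  (forall J : {fset I}, \sum_(i <- J) `|x i| <= M) ->
  cvg (partial_sum x @ totally).
Proof.
move=> xM; apply: qcauchy_cvg; apply/cauchyP => e e0.
pose S (J : {fset I}) := \sum_(i <- J) `|x i|.
have hS : has_sup (range S).
  split; first by exists (S fset0), fset0.
  by exists M => _ [J _ <-]; exact: xM.
have [_ [J0 _ <-] hJ0] := sup_adherent e0 hS.
exists (\sum_(i <- J0) x i); apply: (@near_totally _ J0) => J J0J /=.
rewrite -ball_normE /= distrC partial_sumE (sum_fset_sub _ J0J) addrAC subrr add0r.
apply: le_lt_trans (ler_norm_sum _ _ _) _.
have : S J <= sup (range S) by apply: ub_le_sup; [exact: hS.2|exists J].
by rewrite /S (sum_fset_sub _ J0J); move: hJ0; rewrite /S; lra.
Qed.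

End usum.

Section l2_def.
Context {R : realType} {I : choiceType}.
Implicit Types p q : I -> quat R.

Definition square_summable : {pred I -> quat R} :=
  fun p => `[< (\esum_(k in [set: I]) (`|p k| ^+ 2)%:E < +oo)%E >].

Lemma esum_leP (a : I -> R) (M : R) : (forall k, 0 <= a k) ->
  (\esum_(k in [set: I]) (a k)%:E <= M%:E)%E <->
  (forall J : {fset I}, \sum_(k <- J) a k <= M).
Proof.
move=> a0; split=> [h J|h].
  rewrite -lee_fin; apply: le_trans h; apply: esum_ge.
  exists [set` J]; first by split.
  by rewrite fsbig_finite//= set_fsetK sumEFin.
apply: ge_ereal_sup => _ [X [Xfin _] <-].
by rewrite fsbig_finite//= sumEFin lee_fin.
Qed.

Lemma square_summableP p : reflect
  (exists M, forall J : {fset I}, \sum_(k <- J) `|p k| ^+ 2 <= M)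
  (p \in square_summable).
Proof.
have p0 k : 0 <= `|p k| ^+ 2 by rewrite sqr_ge0.
apply: (iffP (asboolP _)) => [h|[M /esum_leP h]]; last first.
  by apply: le_lt_trans (h p0) _; rewrite ltry.
exists (fine (\esum_(k in [set: I]) (`|p k| ^+ 2)%:E)); apply/esum_leP => //.
by rewrite fineK// ge0_fin_numE// esum_ge0// => k _; rewrite lee_fin.
Qed.

Lemma square_summable_zmod_closed : zmod_closed square_summable.
Proof.
split=> [|p q /square_summableP[M pM] /square_summableP[N qN]].
  by apply/square_summableP; exists 0 => J; rewrite big1// => k _; rewrite normr0 expr0n.
apply/square_summableP; exists (2 * M + 2 * N) => J.
apply: (@le_trans _ _ (\sum_(k <- J) (2 * `|p k| ^+ 2 + 2 * `|q k| ^+ 2))).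
  apply: ler_sum => k _; apply: (@le_trans _ _ ((`|p k| + `|q k|) ^+ 2)).
    by rewrite ler_pXn2r ?nnegrE ?addr_ge0// ler_normB.
  by have := sqr_ge0 (`|p k| - `|q k|); lra.
by rewrite big_split /= -!mulr_sumr; have := pM J; have := qN J; lra.
Qed.

HB.instance Definition _ := GRing.isZmodClosed.Build (I -> quat R)
  square_summable square_summable_zmod_closed.

Lemma square_summable_scale p (a : quat R) :
  p \in square_summable -> (fun k => p k * a) \in square_summable.
Proof.
move=> /square_summableP[M pM]; apply/square_summableP.
exists (M * `|a| ^+ 2) => J.
under eq_bigr do rewrite norm_quatM exprMn.
by rewrite -mulr_suml ler_wpM2r ?sqr_ge0.
Qed.

End l2_def.

Record l2 (R : realType) (I : choiceType) := L2 {
  l2_val :> I -> quat R;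
  l2_valP : l2_val \in square_summable
}.

Section l2_hilbert.
Import summability.
Context {R : realType} {I : choiceType}.
Local Notation l2 := (l2 R I).
Implicit Types p q : l2.

HB.instance Definition _ := [isSub for @l2_val R I].
HB.instance Definition _ := [Choice of l2 by <:].
HB.instance Definition _ := [SubChoice_isSubZmodule of l2 by <:].

Lemma l2P p q : (forall k, p k = q k) -> p = q.
Proof. by move=> pq; apply: val_inj; apply/funext. Qed.

Definition l2_scale p (a : quat R) : l2 :=
  L2 (square_summable_scale a (l2_valP p)).

Fact l2_scalerA p a b : l2_scale p (a * b) = l2_scale (l2_scale p a) b.
Proof. by apply: l2P => k; apply: mulrA. Qed.
Fact l2_scaler1 p : l2_scale p 1 = p.
Proof. by apply: l2P => k; apply: mulr1. Qed.
Fact l2_scalerDl p q a : l2_scale (p + q) a = l2_scale p a + l2_scale q a.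
Proof. by apply: l2P => k; apply: mulrDl. Qed.
Fact l2_scalerDr p a b : l2_scale p (a + b) = l2_scale p a + l2_scale p b.
Proof. by apply: l2P => k; apply: mulrDr. Qed.

HB.instance Definition _ := Zmodule_isRightModule.Build (quat R) l2
  l2_scalerA l2_scaler1 l2_scalerDl l2_scalerDr.

Definition l2_dot p q : quat R := usum (fun k => quat_conj (p k) * q k).

Lemma l2_dot_cvg p q :
  (partial_sum (fun k => quat_conj (p k) * q k) @ totally)
  --> l2_dot p q.
Proof.
have /square_summableP[M pM] := l2_valP p.
have /square_summableP[N qN] := l2_valP q.
apply: (@usum_cvg _ _ (quat R) _ (2^-1 * M + 2^-1 * N)) => J.
apply: (@le_trans _ _
  (\sum_(k <- J) (2^-1 * `|p k| ^+ 2 + 2^-1 * `|q k| ^+ 2))).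
  apply: ler_sum => k _; rewrite norm_quatM norm_quat_conj.
  by have := sqr_ge0 (`|p k| - `|q k|); lra.
by rewrite big_split /= -!mulr_sumr; have := pM J; have := qN J; lra.
Qed.

Let totally_eq_cvg (V : pseudoMetricNormedZmodType R) (u w : I -> V) (v : V) :
  u =1 w -> (partial_sum u @ totally) --> v ->
  (partial_sum w @ totally) --> v.
Proof. by move=> uw; rewrite (_ : u = w)//; apply/funext. Qed.

Fact l2_dot_conj p q : quat_conj (l2_dot p q) = l2_dot q p.
Proof.
have cD : {morph (@quat_conj R) : u w / u + w}.
  by move=> u w; apply: quatP => /=; ring.
have cle (v : quat R) : `|quat_conj v| <= 1 * `|v|.
  by rewrite norm_quat_conj mul1r.
have h := cvg_usum_map cD cle (l2_dot_cvg (p := p) (q := q)).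
apply: (cvg_unique (@norm_hausdorff _ (quat R)) h).
apply: totally_eq_cvg (@l2_dot_cvg q p) => k.
by apply: quatP => /=; ring.
Qed.

Lemma qre_l2_dot_cvg p :
  (partial_sum (fun k => `|p k| ^+ 2) @ totally)
  --> qre (l2_dot p p).
Proof.
have qle (v : quat R) : `|qre v| <= 1 * `|v| by rewrite mul1r norm_qre.
have h := @cvg_usum_map _ _ (quat R) R _ _ _ _ (fun _ _ => erefl) qle
  (l2_dot_cvg (p := p) (q := p)).
apply: totally_eq_cvg h => k.
by rewrite sqr_norm_quat /=; ring.
Qed.

Lemma sum_le_l2_dot p (J : {fset I}) :
  \sum_(k <- J) `|p k| ^+ 2 <= qre (l2_dot p p).
Proof.
apply: (cvgr_to_ge (@qre_l2_dot_cvg p)).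
apply: (@near_totally _ _ J) => J' JJ'.
by rewrite partial_sumE (sum_fset_sub _ JJ') lerDl sumr_ge0// => k _; rewrite sqr_ge0.
Qed.

Lemma l2_dot_le p (M : R) : (forall J : {fset I}, \sum_(k <- J) `|p k| ^+ 2 <= M) ->
  qre (l2_dot p p) <= M.
Proof.
move=> pM; apply: (cvgr_to_le (@qre_l2_dot_cvg p)).
by apply: (@near_totally _ _ fset0) => J _; rewrite partial_sumE.
Qed.

Lemma l2_coord_le p k : `|p k| ^+ 2 <= qre (l2_dot p p).
Proof.
apply: le_trans (sum_le_l2_dot p (fset1 k)).
by rewrite big_seq_fset1.
Qed.

Fact l2_dot_gt0 p : p != 0 -> 0 < qre (l2_dot p p).
Proof.
apply: contraNT; rewrite -leNgt => p0; apply/eqP/l2P => k.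
have := le_trans (l2_coord_le p k) p0.
by rewrite le_eqVlt ltNge sqr_ge0 orbF sqrf_eq0 normr_eq0 => /eqP.
Qed.

Fact l2_dotDr p q r : l2_dot p (q + r) = l2_dot p q + l2_dot p r.
Proof.
apply: (cvg_unique (@norm_hausdorff _ (quat R)) (@l2_dot_cvg p (q + r))).
have h := cvgD (l2_dot_cvg (p := p) (q := q)) (l2_dot_cvg (p := p) (q := r)).
suff <- : partial_sum (fun k => quat_conj (p k) * q k) +
    partial_sum (fun k => quat_conj (p k) * r k) =
  partial_sum (fun k => quat_conj (p k) * (q + r) k) by exact: h.
apply/funext => J; rewrite fctE !partial_sumE -big_split /=.
by apply: eq_bigr => k _; rewrite -mulrDr.
Qed.

Fact l2_dotZr p q a : l2_dot p (q :* a) = l2_dot p q * a.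
Proof.
have aD : {morph (fun v : quat R => v * a) : u w / u + w}.
  by move=> u w; apply: mulrDl.
have ale (v : quat R) : `|v * a| <= `|a| * `|v| by rewrite norm_quatM mulrC.
have h := cvg_usum_map aD ale (l2_dot_cvg (p := p) (q := q)).
apply: (cvg_unique (@norm_hausdorff _ (quat R)) (@l2_dot_cvg p (q :* a))).
by apply: totally_eq_cvg h => k; apply: esym; apply: mulrA.
Qed.

HB.instance Definition _ := RightModule_isQPreHilbert.Build R l2
  l2_dot_conj l2_dot_gt0 l2_dotDr l2_dotZr.

Lemma sqr_norm_l2 p : `|p| ^+ 2 = qre (l2_dot p p).
Proof.
rewrite norm_qdot sqr_sqrtr//.
by apply: le_trans (sum_le_l2_dot p fset0); rewrite big_seq_fset0.
Qed.

Lemma norm_l2_coord p k : `|p k| <= `|p|.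
Proof.
by rewrite -(@ler_pXn2r _ 2) ?nnegrE// sqr_norm_l2 l2_coord_le.
Qed.

Fact l2_complete (F : set_system l2) : ProperFilter F -> cauchy F -> cvg F.
Proof.
move=> FF /cauchyP Fc.
have coordB k p q : (p - q) k = p k - q k by [].
have /choice[l Fl] : forall k, exists l : quat R,
    (fun p : l2 => p k) @ F --> l.
  move=> k; apply/cvg_ex; apply: qcauchy_cvg; apply/cauchyP => e e0.
  have [q Fq] := Fc _ e0; exists (q k).
  apply: (filterS _ Fq : F [set p | ball (q k) e (p k)]) => p.
  rewrite -!ball_normE /= -coordB; exact/le_lt_trans/norm_l2_coord.
have key (e : R) : 0 < e -> exists2 A, F A &
    forall p, A p -> forall J : {fset I}, \sum_(k <- J) `|p k - l k| ^+ 2 <= e ^+ 2.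
  move=> e0; have e2 : 0 < e / 2 by rewrite divr_gt0.
  have [q Fq] := Fc _ e2; exists (ball q (e / 2)) => // p pq J.
  have h : (fun r : l2 => \sum_(k <- J) `|p k - r k| ^+ 2) @ F
      --> \sum_(k <- J) `|p k - l k| ^+ 2.
    elim: (J : seq I) => [|k s IHs].
      under eq_fun do rewrite big_nil.
      by rewrite big_nil; apply: cvg_cst.
    under eq_fun do rewrite big_cons expr2.
    rewrite big_cons expr2; apply: cvgD => //.
    have hk : (fun r : l2 => `|p k - r k|) @ F --> `|p k - l k|.
      by apply: cvg_norm; apply: cvgB; [exact: cvg_cst|exact: Fl].
    exact: cvgM.
  apply: (cvgr_to_le h); near=> r.
  have rq : ball q (e / 2) r by near: r.
  have pr : `|p - r| <= e.
    by apply/ltW; have := ball_splitr pq rq; rewrite -ball_normE.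
  apply: le_trans (sum_le_l2_dot (p - r) J) _.
  by rewrite -sqr_norm_l2 ler_pXn2r ?nnegrE// ltW.
have [A FA Al] := key 1 ltr01.
have [p0 Ap0] := filter_ex FA.
have dl : (fun k => p0 k - l k) \in square_summable.
  by apply/square_summableP; exists (1 ^+ 2); exact: Al.
have lS : l \in square_summable.
  rewrite (_ : l = l2_val p0 - l2_val (L2 dl)); first by rewrite rpredB ?l2_valP.
  by apply/funext => k; rewrite fctE /= opprB addrC subrK.
apply/cvg_ex; exists (L2 lS); apply/fcvgrPdist_lt => e e0.
have e2 : 0 < e / 2 by rewrite divr_gt0.
have [B FB Bl] := key _ e2.
apply: filterS FB => p Bp; rewrite distrC; apply: (@le_lt_trans _ _ (e / 2)).
  rewrite -(@ler_pXn2r _ 2) ?nnegrE ?(ltW e2)// sqr_norm_l2.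
  by apply: l2_dot_le => J; apply: Bl.
by rewrite ltr_pdivrMr// ltr_pMr// ltr1n.
Unshelve. all: by end_near. Qed.

HB.instance Definition _ := QPreHilbert_isComplete.Build R l2 l2_complete.

Fact l2_basis_subproof (k : I) :
  (fun j : I => (if j == k then 1 else 0) : quat R) \in square_summable.
Proof.
apply/square_summableP; exists (`|1 : quat R| ^+ 2) => J.
apply: (@le_trans _ _ (\sum_(j <- fsetU J (fset1 k))
    `|(if j == k then 1 else 0) : quat R| ^+ 2)).
  rewrite [leRHS](sum_fset_sub _ (fsubsetUl J (fset1 k))) lerDl.
  by rewrite sumr_ge0// => j _; rewrite sqr_ge0.
rewrite (big_fsetD1 k) ?inE ?eqxx ?orbT//= big_seq big1 ?addr0// => j.
by rewrite !inE => /andP[/negbTE-> _]; rewrite normr0 expr0n.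
Qed.

Definition l2_basis (k : I) : l2 := L2 (l2_basis_subproof k).

End l2_hilbert.

Section operators.
Context {R : realType} {U V : qpreHilbertType R}.
Implicit Type T : U -> V.

Definition bounded_right_linear T :=
  (forall x y p q, T (x :* p + y :* q) = T x :* p + T y :* q) /\
  (exists C, forall x, `|T x| <= C * `|x|).

(* The vector z with <T x, y> = <x, z> for all x; it exists and is unique when
   U is complete and T is bounded and right linear. *)
Definition adjoint T (y : V) : U :=
  xget 0 [set z | forall x, qdot (T x) y = qdot x z].

(* The vector y of M with x - y orthogonal to M; it exists and is unique when
   V is complete and M is a closed right subspace. *)
Definition orthproj (M : set V) (x : V) : V :=
  xget 0 [set y | M y /\ forall z, M z -> qdot z (x - y) = 0].

End operators.

Definition separable (T : topologicalType) :=
  exists2 D : set T, countable D & dense D.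

Section frames.
Context {R : realType} {V : qhilbertType R} {I : choiceType}.
Implicit Types (f g : I -> V) (K : V -> V).

Definition sqr_coefs f (x : V) : \bar R :=
  \esum_(k in [set: I]) (`|qdot x (f k)| ^+ 2)%:E.

Definition bessel f := exists2 B : R, 0 < B &
  forall x, (sqr_coefs f x <= (B * `|x| ^+ 2)%:E)%E.

Definition Kframe K f := exists A B : R, [/\ 0 < A, 0 < B &
  forall x, ((A * `|adjoint K x| ^+ 2)%:E <= sqr_coefs f x
             <= (B * `|x| ^+ 2)%:E)%E].

(* Kdual includes that f is a K-frame; the reconstruction formula asserts
   convergence of the series, not only the value of its sum. *)
Definition Kdual K f g := [/\ Kframe K f, bessel g &
  forall x, (summability.partial_sum (fun k => f k :* qdot (g k) x)
             @ summability.totally) --> K x].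

Definition synthesis f (c : l2 R I) : V := usum (fun k => f k :* c k).

Definition frame_op f : V -> V := synthesis f \o adjoint (synthesis f).

End frames.

(* Main.v *)
(* Let P be the orthogonal projection onto R(K), T and S the synthesis and frame
   operators of f, and L = S^-1 P_{S(R(K))}. The Bessel sequences are exactly the
   families g_k = N^* e_k with N bounded right linear into l^2 (N being the
   analysis operator of g), and such a g is a K-dual of P f iff P T N = K. Since
   L S P = P and S, P are self-adjoint, P S L^* = P, so N0 = T^* L^* K is one
   solution, with N0^* e_k = K^* L f_k; the others are N0 + M with P T M = 0.
   That L is defined and bounded rests on K^* being bounded below on R(K), which
   follows from the uniform boundedness principle: for y in R(K) with
   |K^* y| <= 1, |<y, K x>| <= |x|. *)
Require Import Defs.
From mathcomp Require Import all_boot all_order all_algebra.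
From mathcomp Require Import all_classical all_reals all_analysis.
From mathcomp Require Import ring lra finmap.
From mathcomp.analysis.showcase Require summability.

Import Order.TTheory GRing.Theory Num.Theory.
Import numFieldNormedType.Exports.

Local Open Scope classical_set_scope.
Local Open Scope ring_scope.

(** * Quaternion conjugation and the embedded reals *)

Section quaternions.
Context {R : realType}.
Implicit Types p q : quat R.

Lemma quat_conjD : {morph (@quat_conj R) : p q / p + q}.
Proof. by move=> p q; apply: quatP => /=; ring. Qed.

Lemma quat_conjM p q : quat_conj (p * q) = quat_conj q * quat_conj p.
Proof. by apply: quatP => /=; ring. Qed.

Definition quat_real (t : R) : quat R := Quat t 0 0 0.

Lemma norm_quat_real t : `|quat_real t| = `|t|.
Proof.
by rewrite norm_quatE /= !expr0n !addr0 sqrtr_sqr.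
Qed.

Lemma quat_conj_mul p : quat_conj p * p = quat_real (`|p| ^+ 2).
Proof. by rewrite sqr_norm_quat; apply: quatP => /=; ring. Qed.

Lemma quat_realM (s t : R) : quat_real s * quat_real t = quat_real (s * t).
Proof. by apply: quatP => /=; ring. Qed.

Lemma quat_conj_real (t : R) : quat_conj (quat_real t) = quat_real t.
Proof. by apply: quatP => /=; ring. Qed.

Lemma quat_mul_conj (p : quat R) : p * quat_conj p = quat_real (`|p| ^+ 2).
Proof. by rewrite sqr_norm_quat; apply: quatP => /=; ring. Qed.

Lemma quat_rscaleE (p q : quat R) : p :* q = p * q.
Proof. by []. Qed.

Lemma norm_quat_half : `|quat_real (2^-1 : R)| = 2^-1.
Proof. by rewrite norm_quat_real ger0_norm// invr_ge0. Qed.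

End quaternions.

(** * Inner product calculus over the quaternions *)

Section inner_product.
Context {R : realType} {V : qpreHilbertType R}.
Implicit Types (x y z : V) (p q : quat R).

Lemma rscale0r x : x :* (0 : quat R) = 0.
Proof. by apply: (addrI (x :* (0 : quat R))); rewrite -rscalerDr !addr0. Qed.

Lemma rscale0l q : (0 : V) :* q = 0.
Proof. by apply: (addrI ((0 : V) :* q)); rewrite -rscalerDl !addr0. Qed.

Lemma rscaleNr x q : x :* (- q) = - (x :* q).
Proof. by apply: (addrI (x :* q)); rewrite -rscalerDr !subrr rscale0r. Qed.

Lemma rscaleNl x q : (- x) :* q = - (x :* q).
Proof. by apply: (addrI (x :* q)); rewrite -rscalerDl !subrr rscale0l. Qed.

Lemma qdot0r x : qdot x 0 = 0.
Proof. by apply: (addrI (qdot x 0)); rewrite -qdotDr !addr0. Qed.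

Lemma qdotNr x y : qdot x (- y) = - qdot x y.
Proof. by apply: (addrI (qdot x y)); rewrite -qdotDr !subrr qdot0r. Qed.

Lemma qdotBr x y z : qdot x (y - z) = qdot x y - qdot x z.
Proof. by rewrite qdotDr qdotNr. Qed.

Lemma qdotDl x y z : qdot (x + y) z = qdot x z + qdot y z.
Proof. by rewrite -qdot_conj qdotDr quat_conjD !qdot_conj. Qed.

Lemma qdot0l x : qdot 0 x = 0.
Proof. by apply: (addrI (qdot 0 x)); rewrite -qdotDl !addr0. Qed.

Lemma qdotNl x y : qdot (- x) y = - qdot x y.
Proof. by apply: (addrI (qdot x y)); rewrite -qdotDl !subrr qdot0l. Qed.

Lemma qdotBl x y z : qdot (x - y) z = qdot x z - qdot y z.
Proof. by rewrite qdotDl qdotNl. Qed.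

Lemma qdotZl x y q : qdot (x :* q) y = quat_conj q * qdot x y.
Proof. by rewrite -qdot_conj qdotZr quat_conjM qdot_conj. Qed.

Lemma qre_qdotC x y : qre (qdot x y) = qre (qdot y x).
Proof. by rewrite -qdot_conj. Qed.

Lemma norm_qdotC x y : `|qdot x y| = `|qdot y x|.
Proof. by rewrite -qdot_conj norm_quat_conj. Qed.

Lemma sqr_norm_qdot x : `|x| ^+ 2 = qre (qdot x x).
Proof.
rewrite norm_qdot sqr_sqrtr//.
by have [->|/qdot_gt0/ltW//] := eqVneq x 0; rewrite qdot0r.
Qed.

(** Conjugate symmetry makes [qdot x x] equal to its own conjugate, so its three imaginary parts
    vanish. *)
Lemma qdot_self x : qdot x x = quat_real (`|x| ^+ 2).
Proof.
have /(congr1 (@qi R)) hi := qdot_conj x x.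
have /(congr1 (@qj R)) hj := qdot_conj x x.
have /(congr1 (@qk R)) hk := qdot_conj x x.
rewrite /= in hi hj hk; rewrite sqr_norm_qdot.
by apply: quatP => //=; lra.
Qed.

Lemma qdot_self_eq0 x : qdot x x = 0 -> x = 0.
Proof.
move=> /(congr1 (@qre R)) /=; rewrite -sqr_norm_qdot => /eqP.
by rewrite sqrf_eq0 normr_eq0 => /eqP.
Qed.

Lemma qdot_ext x y : (forall z, qdot z x = qdot z y) -> x = y.
Proof.
by move=> xy; apply/subr0_eq/qdot_self_eq0; rewrite qdotBr xy subrr.
Qed.

Lemma sqr_normD x y :
  `|x + y| ^+ 2 = `|x| ^+ 2 + 2 * qre (qdot x y) + `|y| ^+ 2.
Proof.
rewrite !sqr_norm_qdot qdotDr !qdotDl /= (qre_qdotC y x); ring.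
Qed.

Lemma sqr_normB x y :
  `|x - y| ^+ 2 = `|x| ^+ 2 - 2 * qre (qdot x y) + `|y| ^+ 2.
Proof. by rewrite sqr_normD qdotNr normrN /= mulrN. Qed.

Lemma norm_rscale x q : `|x :* q| = `|x| * `|q|.
Proof.
apply/eqP; rewrite -(@eqrXn2 _ 2) ?mulr_ge0//; apply/eqP.
rewrite exprMn sqr_norm_qdot qdotZr qdotZl qdot_self sqr_norm_quat /=; ring.
Qed.

(** This is the squared triangle inequality with the squares of the norms cancelled. *)
Lemma qre_qdot_le x y : qre (qdot x y) <= `|x| * `|y|.
Proof.
have : `|x + y| ^+ 2 <= (`|x| + `|y|) ^+ 2.
  by rewrite ler_pXn2r ?nnegrE ?addr_ge0// ler_normD.
rewrite sqr_normD; lra.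
Qed.

(** Rotating [x] by the quaternion [qdot x y] turns the inner product into the real number
    [|qdot x y| ^+ 2], so the bound on real parts applies; one factor [|qdot x y|] then cancels. *)
Lemma qdot_CS x y : `|qdot x y| <= `|x| * `|y|.
Proof.
have [q0|q0] := eqVneq (`|qdot x y|) 0; first by rewrite q0 mulr_ge0.
have qp : 0 < `|qdot x y| by rewrite lt_neqAle eq_sym q0 /=.
have := qre_qdot_le (x :* qdot x y) y.
rewrite qdotZl quat_conj_mul norm_rscale /= expr2 mulrAC.
by rewrite ler_pM2r.
Qed.

End inner_product.

(** * Closed subspaces and orthogonal projections *)

Section closed_subspaces.
Context {R : realType} {V : qhilbertType R}.
Implicit Types (x y z : V) (p q : quat R) (M : set V).

(** Completeness in the form used for minimizing sequences, for preimages under an operator bounded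
    below, and for the gliding hump: the Cauchy rate passes to the limit. *)
Lemma rate_cvg (u : nat -> V) (r : nat -> R) :
  r @ \oo --> 0 -> (forall n m, (n <= m)%N -> `|u m - u n| <= r n) ->
  exists2 l, u @ \oo --> l & forall n, `|l - u n| <= r n.
Proof.
move=> r0 ur.
have /cvg_ex[l ul] : cvg (u @ \oo).
  apply: qcauchy_cvg; apply/cauchyP => e e0.
  move/cvgrPdist_lt: r0 => /(_ _ e0) [N _ rN].
  exists (u N), N => //= m Nm; rewrite -ball_normE /= distrC.
  apply: le_lt_trans (ur _ _ Nm) _; apply: le_lt_trans (ler_norm _) _.
  by have := rN N (leqnn N); rewrite sub0r normrN.
exists l => // n.
have h : (fun m => `|u m - u n|) @ \oo --> `|l - u n|.
  by apply: cvg_norm; apply: cvgB; [exact: ul|exact: cvg_cst].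
apply: (cvgr_to_le h); exists n => // m /=; exact: ur.
Qed.

Definition closed_subspace M :=
  [/\ closed M, M 0 & forall x y p q, M x -> M y -> M (x :* p + y :* q)].

Lemma closed_subspaceD M x y : closed_subspace M -> M x -> M y -> M (x + y).
Proof. by case=> _ _ h Mx My; rewrite -(rscaler1 x) -(rscaler1 y); apply: h. Qed.

Lemma closed_subspaceZ M x p : closed_subspace M -> M x -> M (x :* p).
Proof.
by case=> _ M0 h Mx; rewrite -(addr0 (x :* p)) -(rscale0l p); apply: h.
Qed.

Lemma closed_subspaceB M x y : closed_subspace M -> M x -> M y -> M (x - y).
Proof.
move=> cM Mx My; apply: closed_subspaceD => //.
by rewrite -(rscaler1 y) -rscaleNr; apply: closed_subspaceZ.
Qed.

Lemma rscale_halfD x : (x + x) :* quat_real (2^-1 : R) = x.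
Proof.
rewrite rscalerDl -rscalerDr -[RHS]rscaler1; congr rscale.
by apply: quatP => /=; lra.
Qed.

(** A sequence in [M] whose squared distances to [x] are within [n.+1%:R^-1 ^+ 2] of the infimum is
    Cauchy by the parallelogram law, with rate [2 / n.+1]; its limit attains the infimum. *)
Lemma nearest_point M x : closed_subspace M ->
  exists2 y, M y & forall m, M m -> `|x - y| ^+ 2 <= `|x - m| ^+ 2.
Proof.
move=> cM; pose E := [set `|x - m| ^+ 2 | m in M].
have [Mcl M0 Mlin] := cM.
have hE : has_inf E.
  split; first by exists (`|x - 0| ^+ 2), 0.
  by exists 0 => _ [m _ <-]; exact: sqr_ge0.
have infE m : M m -> inf E <= `|x - m| ^+ 2.
  by move=> Mm; apply: ge_inf; [exact: hE.2|exists m].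
have /choice[u hu] : forall n : nat, exists y, M y /\
    `|x - y| ^+ 2 < inf E + (n.+1%:R^-1) ^+ 2.
  move=> n; have e0 : 0 < (n.+1%:R^-1 : R) ^+ 2 by rewrite exprn_gt0// invr_gt0.
  by have [_ [y My <-] hy] := inf_adherent e0 hE; exists y.
have r0 : (fun n => 2 * n.+1%:R^-1 : R) @ \oo --> 0.
  rewrite -[X in _ --> X](mulr0 2); apply: cvgM; first exact: cvg_cst.
  exact: cvg_harmonic.
have [n m nm|l ul _] := @rate_cvg u _ r0.
  have [[Mn hn] [Mm hm]] := (hu n, hu m).
  have ninv : (m.+1%:R^-1 : R) <= n.+1%:R^-1 by rewrite lef_pV2 ?posrE// ler_nat.
  have minv : 0 < (m.+1%:R^-1 : R) by rewrite invr_gt0.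
  (* The midpoint of [u n] and [u m] lies in [M], so its squared distance to [x] is at least
     [inf E]; doubling the vector gives the factor 4. *)
  have mid : `|x - u n + (x - u m)| ^+ 2 >= 4 * inf E.
    have := infE _ (Mlin _ _ (quat_real 2^-1) (quat_real 2^-1) Mn Mm).
    rewrite -{1}(rscale_halfD x) -!rscalerDl -rscaleNl -rscalerDl norm_rscale.
    rewrite norm_quat_half exprMn opprD addrACA; lra.
  rewrite -(@ler_pXn2r _ 2) ?nnegrE ?mulr_ge0// ?invr_ge0//.
  have -> : u m - u n = (x - u n) - (x - u m).
    by rewrite opprB [RHS]addrC addrA subrK.
  move: mid hn hm; rewrite (sqr_normB (x - u n)) (sqr_normD (x - u n)).
  have : (m.+1%:R^-1 : R) ^+ 2 <= n.+1%:R^-1 ^+ 2.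
    by rewrite ler_pXn2r// nnegrE ltW// (lt_le_trans minv).
  rewrite exprMn; move: (qre _) (`|x - u n| ^+ 2) (`|x - u m| ^+ 2) => a b c.
  move: (n.+1%:R^-1 ^+ 2) (m.+1%:R^-1 ^+ 2) (inf E) => s t D; lra.
exists l; first by apply: (closed_cvg M Mcl _ l ul); apply: nearW => n; exact: (hu n).1.
move=> m Mm; apply: le_trans (infE _ Mm).
have hxu : (fun n => `|x - u n| ^+ 2) @ \oo --> `|x - l| ^+ 2.
  under eq_fun do rewrite expr2; rewrite expr2.
  have h : (fun n => `|x - u n|) @ \oo --> `|x - l|.
    by apply: cvg_norm; apply: cvgB; [exact: cvg_cst|exact: ul].
  exact: cvgM.
have hinf : (fun n => inf E + (n.+1%:R^-1) ^+ 2) @ \oo --> inf E.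
  rewrite -[X in _ --> X]addr0 -[X in _ + X](mul0r 0); apply: cvgD.
    exact: cvg_cst.
  under eq_fun do rewrite expr2.
  by apply: cvgM; apply: cvg_harmonic.
by apply: (ler_cvg_to hxu hinf); apply: nearW => n; apply/ltW/(hu n).2.
Qed.

(** The nearest point qualifies: were [w = x - y] not orthogonal to [z], moving [y] slightly along
    [z] would bring it closer to [x]. *)
Lemma orthproj_spec M x : closed_subspace M ->
  M (orthproj M x) /\ forall z, M z -> qdot z (x - orthproj M x) = 0.
Proof.
move=> cM; apply: (@xgetPex _ 0
  [set y | M y /\ forall z, M z -> qdot z (x - y) = 0]).
have [y My ymin] := nearest_point M x cM.
exists y; split=> // z Mz; set w := x - y.
apply/eqP; rewrite -normr_eq0; apply/eqP.
(* The step [z :* q] changes the squared distance by [- |qdot z w| ^+ 2 * t * (2 - t * |z| ^+ 2)].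
   The choice of [t] gives [t * |z| ^+ 2 < 1], and the [+ 1] covers [z = 0]. *)
pose t := (`|z| ^+ 2 + 1)^-1; pose q := qdot z w * quat_real t.
have d0 : 0 < `|z| ^+ 2 + 1 by rewrite ltr_wpDl.
have t0 : 0 < t by rewrite invr_gt0.
have tE : t * (`|z| ^+ 2 + 1) = 1 by rewrite mulVf// gt_eqF.
have := ymin _ (closed_subspaceD _ _ _ cM My (closed_subspaceZ _ _ q cM Mz)).
rewrite opprD addrA -/w (sqr_normB w) qdotZr norm_rscale.
rewrite -(qdot_conj z w) /q mulrA quat_conj_mul norm_quatM norm_quat_real.
rewrite (ger0_norm (ltW t0)) /= !exprMn.
move: (`|w| ^+ 2) (`|qdot z w|) (normr_ge0 (qdot z w)) => a b b0 h.
have {}h : b ^+ 2 * (t * (2 - t * `|z| ^+ 2)) <= 0 by lra.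
have t2 : 0 < t * (2 - t * `|z| ^+ 2) by rewrite mulr_gt0//; lra.
by apply/eqP; rewrite -sqrf_eq0 eq_le sqr_ge0 andbT -(pmulr_lle0 _ t2).
Qed.

Lemma orthproj_in M x : closed_subspace M -> M (orthproj M x).
Proof. by move=> /(orthproj_spec M x)[]. Qed.

Lemma orthproj_orth M x z : closed_subspace M -> M z ->
  qdot z (orthproj M x) = qdot z x.
Proof.
move=> cM Mz; have [_ /(_ _ Mz)] := orthproj_spec M x cM.
by rewrite qdotBr => /subr0_eq.
Qed.

Lemma orthproj_uniq M x y : closed_subspace M -> M y ->
  (forall z, M z -> qdot z y = qdot z x) -> orthproj M x = y.
Proof.
move=> cM My h; apply/subr0_eq/qdot_self_eq0.
have Md : M (orthproj M x - y).
  by apply: closed_subspaceB => //; exact: orthproj_in.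
by rewrite qdotBr h// orthproj_orth// subrr.
Qed.

Lemma orthproj_id M x : closed_subspace M -> M x -> orthproj M x = x.
Proof. by move=> cM Mx; apply: orthproj_uniq. Qed.

Lemma orthproj_self_adjoint M x y : closed_subspace M ->
  qdot (orthproj M x) y = qdot x (orthproj M y).
Proof.
move=> cM; rewrite -(orthproj_orth M y) ?orthproj_in//; last exact: orthproj_in.
by rewrite -qdot_conj orthproj_orth ?qdot_conj//; exact: orthproj_in.
Qed.

Lemma norm_orthproj_le M x : closed_subspace M -> `|orthproj M x| <= `|x|.
Proof.
move=> cM; have [->//|n0] := eqVneq (`|orthproj M x|) 0.
have np : 0 < `|orthproj M x| by rewrite lt_neqAle eq_sym n0 /=.
rewrite -(ler_pM2l np) -expr2 sqr_norm_qdot orthproj_orth//; last exact: orthproj_in.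
exact: qre_qdot_le.
Qed.

Lemma orthproj_brl M : closed_subspace M -> bounded_right_linear (orthproj M).
Proof.
move=> cM; split=> [x y p q|].
  apply: orthproj_uniq => //.
    by case: (cM) => _ _; apply; exact: orthproj_in.
  by move=> z Mz; rewrite !qdotDr !qdotZr !orthproj_orth.
by exists 1 => x; rewrite mul1r norm_orthproj_le.
Qed.

End closed_subspaces.

(** * Bounded operators, Riesz representation, adjoints and uniform boundedness *)

Section bounded_operators.
Context {R : realType}.

Lemma cvg_additive (U W : pseudoMetricNormedZmodType R) (T : U -> W) (C : R)
    (A : Type) (F : set_system A) (FF : Filter F) (u : A -> U) (l : U) :
  {morph T : x y / x - y} -> (forall x, `|T x| <= C * `|x|) ->
  u @ F --> l -> (T \o u) @ F --> T l.
Proof.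
move=> TB TC /cvgrPdist_lt ul; apply/cvgrPdist_lt => e e0.
(* [C] may be zero or negative; [|C| + 1] is a bound that can be divided by. *)
have C1 : 0 < `|C| + 1 by rewrite ltr_wpDl.
have := ul (e / (`|C| + 1)); rewrite divr_gt0// => /(_ isT).
apply: filterS => a; rewrite ltr_pdivlMr// mulrC /= -TB.
apply: le_lt_trans; apply: le_trans (TC _) _.
by rewrite ler_wpM2r// (le_trans (ler_norm _))// lerDl.
Qed.

Section algebra.
Context {U W : qpreHilbertType R} {T : U -> W} (Tbrl : bounded_right_linear T).

Lemma brlZ x p : T (x :* p) = T x :* p.
Proof.
have := Tbrl.1 x 0 p 0; rewrite !rscale0r !addr0; exact.
Qed.

Lemma brlD : {morph T : x y / x + y}.
Proof. by move=> x y; have := Tbrl.1 x y 1 1; rewrite !rscaler1. Qed.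

Lemma brl0 : T 0 = 0.
Proof. by rewrite -(rscale0r (0 : U)) brlZ rscale0r. Qed.

Lemma brlB : {morph T : x y / x - y}.
Proof. by move=> x y; rewrite brlD -{1}(rscaler1 y) -rscaleNr brlZ rscaleNr rscaler1. Qed.

Lemma brl_bound : exists2 C, 0 <= C & forall x, `|T x| <= C * `|x|.
Proof.
have [_ [C TC]] := Tbrl; exists `|C| => // x.
by apply: le_trans (TC x) _; rewrite ler_wpM2r// ler_norm.
Qed.

Lemma brl_cvg {A : Type} {F : set_system A} {FF : Filter F} (u : A -> U) l :
  u @ F --> l -> (T \o u) @ F --> T l.
Proof. have [_ [C TC]] := Tbrl; exact: cvg_additive brlB TC. Qed.

Lemma brl_continuous : continuous T.
Proof. by move=> x; apply: (brl_cvg idfun); exact: cvg_id. Qed.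

End algebra.

Lemma brl_comp (U W X : qpreHilbertType R) (S : W -> X) (T : U -> W) :
  bounded_right_linear S -> bounded_right_linear T ->
  bounded_right_linear (S \o T).
Proof.
move=> Sb Tb; split=> [x y p q|]; first by rewrite /= Tb.1 Sb.1.
have [[C C0 SC] [D D0 TD]] := (brl_bound Sb, brl_bound Tb).
exists (C * D) => x; rewrite /= -mulrA; apply: le_trans (SC _) _.
by rewrite ler_wpM2l.
Qed.

Lemma brl_sub (U W : qpreHilbertType R) (S T : U -> W) :
  bounded_right_linear S -> bounded_right_linear T ->
  bounded_right_linear (fun x => S x - T x).
Proof.
move=> Sb Tb; split=> [x y p q|].
  by rewrite Tb.1 Sb.1 !rscalerDl !rscaleNl opprD addrACA.
have [[C C0 SC] [D D0 TD]] := (brl_bound Sb, brl_bound Tb).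
exists (C + D) => x; apply: le_trans (ler_normB _ _) _.
by rewrite mulrDl lerD.
Qed.

Lemma closed_preimage0 (U W : qpreHilbertType R) (T : U -> W) :
  bounded_right_linear T -> closed [set x | T x = 0].
Proof.
move=> Tb; apply: (@preimage_closed _ _ T [set 0]).
  by move=> x _; exact: brl_continuous.
exact/accessible_closed_set1/hausdorff_accessible/norm_hausdorff.
Qed.

(** Take [v] orthogonal to the kernel [N] with [phi v = 1]. Then [x - v :* phi x] lies in [N], so
    [qdot v x] is [|v| ^+ 2] times [phi x], and [v] divided by [|v| ^+ 2] represents [phi]. *)
Lemma riesz (U : qhilbertType R) (phi : U -> quat R) :
  bounded_right_linear phi -> exists z, forall x, phi x = qdot z x.
Proof.
move=> phib; have [phi0|] := pselect (forall x, phi x = 0).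
  by exists 0 => x; rewrite phi0 qdot0l.
move=> /existsNP[x0 /eqP phix0]; pose N := [set x | phi x = 0].
have cN : closed_subspace N.
  split; [exact: closed_preimage0|exact: brl0|].
  by move=> x y p q; rewrite /N /= => x_0 y_0; rewrite phib.1 x_0 y_0 !rscale0l addr0.
pose c := phi x0; pose w := x0 - orthproj N x0.
have phiw : phi w = c.
  rewrite (brlB phib) (_ : phi (orthproj N x0) = 0) ?subr0//.
  exact: (orthproj_in N x0 cN).
pose v := w :* (quat_conj c * quat_real (`|c| ^+ 2)^-1).
have phiv : phi v = 1.
  rewrite (brlZ phib) phiw.
  by rewrite quat_rscaleE mulrA quat_mul_conj quat_realM mulfV// expf_eq0 normr_eq0.
have vN n : N n -> qdot v n = 0.
  move=> Nn; rewrite qdotZl -qdot_conj (_ : qdot n w = 0).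
    by apply: quatP => /=; ring.
  by case: (orthproj_spec N x0 cN) => _; apply.
have v0 : `|v| ^+ 2 != 0.
  rewrite expf_eq0 normr_eq0 /=; apply/eqP => v0.
  by move/eqP: phiv; rewrite v0 (brl0 phib) eq_sym oner_eq0.
exists (v :* quat_real (`|v| ^+ 2)^-1) => x.
have /vN : N (x - v :* phi x); last first.
  rewrite qdotBr qdotZr qdot_self (qdotZl v) => /subr0_eq ->.
  by rewrite quat_conj_real mulrA quat_realM mulVf// mul1r.
rewrite /N /= (brlB phib) (brlZ phib) phiv.
by rewrite quat_rscaleE mul1r subrr.
Qed.

Section adjoint.
Context {U : qhilbertType R} {W : qpreHilbertType R} {T : U -> W}.
Hypothesis Tbrl : bounded_right_linear T.

(** [adjoint] is a choice with default 0, so a witness is needed: it represents the functional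
    sending [x] to [qdot y (T x)], which is right linear because [qdot] is so in its second
    argument. *)
Lemma adjointP x y : qdot (T x) y = qdot x (adjoint T y).
Proof.
suff : exists z, forall x, qdot (T x) y = qdot x z.
  by move=> /(@xgetPex _ 0 [set z | forall x, qdot (T x) y = qdot x z]); apply.
have [|z hz] := @riesz U (fun x => qdot y (T x)).
  split=> [x1 x2 p q|]; first by rewrite Tbrl.1 qdotDr !qdotZr.
  have [C C0 TC] := brl_bound Tbrl.
  exists (`|y| * C) => x1; apply: le_trans (qdot_CS _ _) _.
  by rewrite -mulrA ler_wpM2l.
by exists z => x1; rewrite -qdot_conj hz qdot_conj.
Qed.

Lemma adjointPl x y : qdot (adjoint T y) x = qdot y (T x).
Proof. by rewrite -qdot_conj -adjointP qdot_conj. Qed.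

Lemma adjoint_uniq y z : (forall x, qdot (T x) y = qdot x z) -> adjoint T y = z.
Proof. by move=> h; apply: qdot_ext => x; rewrite -adjointP h. Qed.

(** The bound [C] of [T] serves again: [|T^* y| ^+ 2] is the real part of [qdot (T (T^* y)) y], at
    most [C * |T^* y| * |y|]. *)
Lemma adjoint_brl : bounded_right_linear (adjoint T).
Proof.
split=> [x y p q|].
  by apply: adjoint_uniq => z; rewrite !qdotDr !qdotZr !adjointP.
have [C C0 TC] := brl_bound Tbrl; exists C => y.
have [->|n0] := eqVneq (`|adjoint T y|) 0; first by rewrite mulr_ge0.
have np : 0 < `|adjoint T y| by rewrite lt_neqAle eq_sym n0 /=.
rewrite -(ler_pM2l np) -expr2 sqr_norm_qdot -adjointP.
apply: le_trans (qre_qdot_le _ _) _.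
by rewrite mulrA ler_wpM2r// mulrC.
Qed.

End adjoint.

(* Gliding hump: if A is unbounded, steps of size 3 ^- n along elements of A
   whose norms grow faster than 3 ^+ n lead to a limit on which A is not
   pointwise bounded. *)
Lemma weakly_bounded_bounded (V : qhilbertType R) (A : set V) :
  (forall z, exists b, forall y, A y -> `|qdot y z| <= b) ->
  exists C, forall y, A y -> `|y| <= C.
Proof.
move=> Aw; apply: contrapT => Aub.
have big (b : R) : exists y, A y /\ b < `|y|.
  apply: contrapT => h; apply: Aub; exists b => y Ay.
  by rewrite leNgt; apply/negP => yb; apply: h; exists y.
have /choice[y hy] : forall n : nat, exists y, A y /\ n%:R * 3 ^+ n < `|y|.
  by move=> n; exact: big.
have stepE (n : nat) (x : V) : exists x', `|x' - x| <= 3 ^- n /\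
    3 ^- n * `|y n| <= `|qdot (y n) x'|.
  have yn0 : 0 < `|y n| by apply: le_lt_trans (hy n).2; rewrite mulr_ge0// exprn_ge0.
  have r0 : 0 < (3 ^- n : R) by rewrite invr_gt0 exprn_gt0.
  pose s := y n :* quat_real (3 ^- n * `|y n|^-1).
  have ns : `|s| = 3 ^- n.
    rewrite norm_rscale norm_quat_real ger0_norm; last first.
      by rewrite mulr_ge0 ?ltW// invr_gt0.
    by rewrite mulrCA mulfV ?mulr1 ?gt_eqF.
  have ds : `|qdot (y n) s| = 3 ^- n * `|y n|.
    rewrite qdotZr qdot_self quat_realM norm_quat_real ger0_norm.
      by rewrite mulrCA expr2 mulfK// gt_eqF.
    by rewrite !mulr_ge0 ?invr_ge0// ltW.
  (* The inner products of [y n] with [x + s] and [x - s] differ by [2 * 3 ^- n * |y n|] in norm, so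
     at least one of them is as large as required. *)
  have [h|h] := lerP (3 ^- n * `|y n|) `|qdot (y n) (x + s)|.
    by exists (x + s); rewrite addrC addKr ns.
  exists (x - s); split; first by rewrite addrC addKr normrN ns.
  have := ler_normB (qdot (y n) (x + s)) (qdot (y n) (x - s)).
  have -> : qdot (y n) (x + s) - qdot (y n) (x - s) = qdot (y n) s *+ 2.
    by rewrite -qdotBr opprB (addrC x) addrACA subrr addr0 qdotDr mulr2n.
  rewrite normrMn ds; lra.
have /choice[phi phiP] : forall nx : nat * V, exists x', `|x' - nx.2| <= 3 ^- nx.1 /\
    3 ^- nx.1 * `|y nx.1| <= `|qdot (y nx.1) x'|.
  by move=> [n x]; exact: stepE.
pose u := fix u n := if n is m.+1 then phi (m.+1, u m) else 0.
have uS n : `|u n.+1 - u n| <= 3 ^- n.+1 := (phiP (n.+1, u n)).1.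
have uy n : 3 ^- n.+1 * `|y n.+1| <= `|qdot (y n.+1) (u n.+1)| := (phiP (n.+1, u n)).2.
(* Geometric sum of the later steps. All steps after [n] together move [u n] by at most half of
   [3 ^- n], so they cannot undo the hump made at step [n]. *)
have tail n k : `|u (n + k)%N - u n| <= 2^-1 * 3 ^- n * (1 - 3 ^- k).
  elim: k => [|k IH]; first by rewrite addn0 subrr normr0 expr0 invr1 subrr mulr0.
  rewrite addnS -(subrK (u (n + k)%N) (u (n + k).+1)) -addrA.
  apply: le_trans (ler_normD _ _) _.
  have := lerD (uS (n + k)%N) IH; move=> /le_trans; apply.
  have -> : (3 ^- (n + k).+1 : R) = 3^-1 * (3 ^- n * 3 ^- k).
    by rewrite exprS exprD !invfM.
  rewrite (_ : (3 ^- k.+1 : R) = 3^-1 * 3 ^- k); last by rewrite exprS invfM.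
  lra.
have r0 : (fun n => 2^-1 * 3 ^- n : R) @ \oo --> 0.
  rewrite -[X in _ --> X](mulr0 2^-1); apply: cvgM; first exact: cvg_cst.
  under eq_fun do rewrite -exprVn.
  by apply: cvg_expr; rewrite ger0_norm ?invr_ge0// invf_lt1// ltr1n.
have [n m nm|l _ ul] := @rate_cvg _ _ u _ r0.
  rewrite -(subnKC nm); apply: le_trans (tail _ _) _.
  apply: ler_piMr; last by rewrite gerBl invr_ge0 exprn_ge0.
  by rewrite mulr_ge0// invr_ge0// exprn_ge0.
have [b hb] := Aw l.
have [n hn] : exists n : nat, b *+ 2 < n.+1%:R.
  exists (Num.bound (b *+ 2)).
  by apply: lt_trans (unstable.ltr_bound _) _; rewrite ltr_nat.
have [An yn] := hy n.+1.
have := hb _ An; apply/negP; rewrite -ltNge.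
(* At least half of the hump survives in the limit: [|qdot (y n.+1) l|] is at least
   [2^-1 * 3 ^- n.+1 * |y n.+1|], which exceeds [n.+1%:R / 2] and hence [b]. *)
have lu : `|qdot (y n.+1) (l - u n.+1)| <= `|y n.+1| * (2^-1 * 3 ^- n.+1).
  by apply: le_trans (qdot_CS _ _) _; rewrite ler_wpM2l.
have := lerB_normD (qdot (y n.+1) (u n.+1)) (qdot (y n.+1) (l - u n.+1)).
rewrite -qdotDr [u _ + _]addrC subrK; apply: lt_le_trans.
have r3 : 0 < (3 ^- n.+1 : R) by rewrite invr_gt0 exprn_gt0.
have : n.+1%:R < 3 ^- n.+1 * `|y n.+1|.
  by rewrite -ltr_pdivrMl// invrK mulrC.
by move: lu (uy n); lra.
Qed.

End bounded_operators.

(** * The standard basis of the sequence space *)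

Section l2_space.
Import summability.
#[local] Existing Instance totally_filter.
Context {R : realType} {I : choiceType}.
Local Notation l2 := (l2 R I).
Implicit Types c : l2.

Lemma esum_l2 c : (\esum_(k in [set: I]) (`|c k| ^+ 2)%:E = (`|c| ^+ 2)%:E)%E.
Proof.
have c0 k : 0 <= `|c k| ^+ 2 by rewrite sqr_ge0.
apply/eqP; rewrite eq_le; apply/andP; split.
  by apply/(esum_leP _ c0) => J; rewrite sqr_norm_l2 sum_le_l2_dot.
have e0 : (0 <= \esum_(k in [set: I]) (`|c k| ^+ 2)%:E)%E.
  by apply: esum_ge0 => k _; rewrite lee_fin.
have efin : (\esum_(k in [set: I]) (`|c k| ^+ 2)%:E)%E \is a fin_num.
  by rewrite ge0_fin_numE//; exact/asboolP/(l2_valP c).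
rewrite -(fineK efin) lee_fin sqr_norm_l2.
by apply: l2_dot_le; apply/(esum_leP _ c0); rewrite fineK.
Qed.

Lemma qdot_l2_basis (k : I) c : qdot (l2_basis k) c = c k.
Proof.
apply: (cvg_unique (@norm_hausdorff _ (quat R)) (l2_dot_cvg (p := l2_basis k) (q := c))).
apply/cvgrPdist_lt => e e0; exists [fset k]%fset => // J /= kJ.
rewrite partial_sumE (bigD1_seq k) ?fset_uniq//=; last by rewrite -fsub1set.
rewrite eqxx big1 => [|j /negbTE ->].
  rewrite addr0 (_ : quat_conj 1 = 1) ?mul1r ?subrr ?normr0//.
  by apply: quatP => /=; rewrite ?oppr0.
by rewrite (_ : quat_conj 0 = 0) ?mul0r//; apply: quatP; rewrite /= ?oppr0.
Qed.

(** For the partial sum [s] over [J], both [qdot c s] and [qdot s s] have real part the sum of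
    [|c k| ^+ 2] over [J]. Hence [|c - s| ^+ 2] is the remainder of the series for [|c| ^+ 2]. *)
Lemma l2_basis_cvg c :
  (partial_sum (fun k => l2_basis k :* c k) @ totally) --> c.
Proof.
apply/cvgrPdist_lt => e e0.
have := qre_l2_dot_cvg (p := c).
move/cvgrPdist_lt => /(_ (e ^+ 2)); rewrite exprn_gt0// => /(_ isT).
apply: filterS => J; rewrite !partial_sumE -sqr_norm_l2 => hJ.
set s := \sum_(k <- J) l2_basis k :* c k.
have sk k : k \in J -> qdot (l2_basis k) s = c k.
  move=> kJ; rewrite (big_morph _ (qdotDr (l2_basis k)) (qdot0r (l2_basis k))).
  rewrite (bigD1_seq k) ?fset_uniq//= big1 => [|j jk].
    by rewrite addr0 qdotZr qdot_l2_basis /= eqxx mul1r.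
  by rewrite qdotZr qdot_l2_basis /= eq_sym (negbTE jk) mul0r.
have dotE (x : l2) : (forall k, k \in J -> qdot (l2_basis k) x = c k) ->
    qre (qdot x s) = \sum_(k <- J) `|c k| ^+ 2.
  move=> xc; rewrite (big_morph _ (qdotDr x) (qdot0r x)).
  rewrite (big_morph (@qre R) (id1 := 0) (op1 := +%R))//.
  rewrite !big_seq; apply: eq_bigr => k kJ.
  by rewrite qdotZr -qdot_conj xc// quat_conj_mul.
rewrite -(@ltr_pXn2r _ 2) ?nnegrE ?(ltW e0)// sqr_normB.
rewrite (sqr_norm_qdot s) (dotE s sk) (dotE c); last by move=> k _; exact: qdot_l2_basis.
apply: le_lt_trans hJ; apply: le_trans (ler_norm _); lra.
Qed.

End l2_space.

(** * Analysis, synthesis and frame operators of Bessel sequences *)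

Section bessel.
Import summability.
#[local] Existing Instance totally_filter.
Context {R : realType} {V : qhilbertType R} {I : choiceType}.
Implicit Types f g : I -> V.

Lemma bessel_square_summable f x : bessel f ->
  (fun k => qdot (f k) x) \in square_summable.
Proof.
move=> [B _ fB]; apply/asboolP.
under eq_esum do rewrite norm_qdotC.
by apply: le_lt_trans (fB x) _; rewrite ltry.
Qed.

(** Built before [synthesis] is known to converge: the Bessel bound makes this operator bounded, and
    [synthesis] is then identified with its adjoint. *)
Definition analysis f (bf : bessel f) (x : V) : l2 R I :=
  L2 (bessel_square_summable f x bf).

Lemma sqr_coefs_analysis f (bf : bessel f) x :
  sqr_coefs f x = (`|analysis f bf x| ^+ 2)%:E.
Proof.
by rewrite -esum_l2 /sqr_coefs; apply: eq_esum => k _; rewrite norm_qdotC.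
Qed.

Lemma analysis_brl f (bf : bessel f) : bounded_right_linear (analysis f bf).
Proof.
split=> [x y p q|].
  by apply: l2P => k /=; rewrite qdotDr !qdotZr.
have [B B0 fB] := bf; exists (Num.sqrt B) => x.
rewrite -(@ler_pXn2r _ 2) ?nnegrE ?mulr_ge0 ?sqrtr_ge0//.
rewrite exprMn (sqr_sqrtr (ltW B0)).
by have := fB x; rewrite (sqr_coefs_analysis f bf) lee_fin.
Qed.

Lemma adjoint_analysis_basis f (bf : bessel f) k :
  adjoint (analysis f bf) (l2_basis k) = f k.
Proof.
apply: (adjoint_uniq (analysis_brl f bf)) => x.
by rewrite -qdot_conj qdot_l2_basis qdot_conj.
Qed.

(** The adjoint of [analysis] is bounded and sends [l2_basis k] to [f k]; applied to the basis
    expansion of [c] it yields the series. *)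
Lemma synthesis_cvg f (bf : bessel f) (c : l2 R I) :
  (partial_sum (fun k => f k :* c k) @ totally) --> adjoint (analysis f bf) c.
Proof.
have ab := adjoint_brl (analysis_brl f bf).
have [C C0 aC] := brl_bound ab.
have := cvg_usum_map (brlD ab) aC (l2_basis_cvg c).
rewrite (_ : _ \o _ = fun k => f k :* c k)//.
by apply/funext => k; rewrite /= (brlZ ab) adjoint_analysis_basis.
Qed.

Lemma synthesisE f (bf : bessel f) : synthesis f = adjoint (analysis f bf).
Proof.
by apply/funext => c; apply: cvg_lim; [exact: norm_hausdorff|exact: synthesis_cvg].
Qed.

Lemma synthesis_brl f : bessel f -> bounded_right_linear (@synthesis R V I f).
Proof. by move=> bf; rewrite synthesisE; apply/adjoint_brl/analysis_brl. Qed.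

Lemma adjoint_synthesis f (bf : bessel f) : adjoint (synthesis f) = analysis f bf.
Proof.
apply/funext => x; apply: (adjoint_uniq (synthesis_brl f bf)) => c.
by rewrite (synthesisE f bf) (adjointPl (analysis_brl f bf)).
Qed.

Lemma frame_op_brl f : bessel f -> bounded_right_linear (frame_op f).
Proof.
move=> bf; rewrite /frame_op (adjoint_synthesis f bf).
exact: brl_comp (synthesis_brl f bf) (analysis_brl f bf).
Qed.

Lemma qdot_frame_op f (bf : bessel f) x y :
  qdot (frame_op f x) y = qdot (analysis f bf x) (analysis f bf y).
Proof.
by rewrite /frame_op (adjoint_synthesis f bf) /= (synthesisE f bf)
  (adjointPl (analysis_brl f bf)).
Qed.

Lemma frame_op_self_adjoint f x y : bessel f ->
  qdot (frame_op f x) y = qdot x (frame_op f y).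
Proof.
move=> bf.
by rewrite -(qdot_conj (frame_op f y)) !(qdot_frame_op f bf) qdot_conj.
Qed.

(** The coefficients of [x] are, up to conjugation, the coordinates of [N x], so their squares sum
    to [|N x| ^+ 2]. The bound is [C ^+ 2 + 1] because a Bessel bound must be positive and [C] may
    be 0. *)
Lemma bessel_adjoint_basis (N : V -> l2 R I) : bounded_right_linear N ->
  bessel (fun k => adjoint N (l2_basis k)).
Proof.
move=> Nb; have [C C0 NC] := brl_bound Nb; exists (C ^+ 2 + 1) => [|x].
  by rewrite ltr_wpDl// exprn_ge0.
rewrite /sqr_coefs.
under eq_esum do rewrite -(adjointP Nb) norm_qdotC.
under eq_esum do rewrite qdot_l2_basis.
rewrite esum_l2 lee_fin mulrDl mul1r ler_wpDr//.
by rewrite -exprMn ler_pXn2r ?nnegrE ?mulr_ge0.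
Qed.

End bessel.

(** * Inverting an operator that is bounded below on a closed subspace *)

Section bounded_below.
Context {R : realType} {V : qhilbertType R} {W : qhilbertType R}.
Context {T : V -> W} {M : set V} {c : R}.
Hypotheses (Tbrl : bounded_right_linear T) (cM : closed_subspace M).
Hypothesis T_below : forall x, M x -> `|x| <= c * `|T x|.

Lemma bounded_below_inj : {in M &, injective T}.
Proof.
move=> x y /set_mem Mx /set_mem My Txy; apply: subr0_eq.
have := T_below _ (closed_subspaceB _ _ _ cM Mx My).
by rewrite (brlB Tbrl) Txy subrr normr0 mulr0 normr_le0 => /eqP.
Qed.

(** If [T (u n)] tends to [y], the lower bound makes [u] Cauchy; its limit stays in [M] and is
    mapped to [y]. *)
Lemma bounded_below_closed : closed_subspace (T @` M).
Proof.
have [Mcl M0 Mlin] := cM; split.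
- move=> y; rewrite closureEnbhs => yM.
  have /choice[u hu] : forall n : nat, exists x, M x /\ `|y - T x| < n.+1%:R^-1.
    move=> n; have e0 : 0 < (n.+1%:R^-1 : R) by rewrite invr_gt0.
    have [_ [[x Mx <-]]] := yM _ _ (fun _ h => h) (nbhsx_ballx y _ e0).
    by rewrite -ball_normE; exists x.
  (* The factor 2 comes from comparing [T (u m)] and [T (u n)] through [y]; [|c|] stands in for [c],
     whose sign is not given. *)
  have r0 : (fun n => `|c| * (2 * n.+1%:R^-1) : R) @ \oo --> 0.
    rewrite -[X in _ --> X](mulr0 `|c|); apply: cvgM; first exact: cvg_cst.
    rewrite -[X in _ --> X](mulr0 2); apply: cvgM; first exact: cvg_cst.
    exact: cvg_harmonic.
  have [n m nm|l ul _] := rate_cvg u _ r0.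
    have [[Mn hn] [Mm hm]] := (hu n, hu m).
    apply: le_trans (T_below _ (closed_subspaceB _ _ _ cM Mm Mn)) _.
    apply: le_trans (ler_wpM2r (normr_ge0 _) (ler_norm c)) _.
    rewrite ler_wpM2l// (brlB Tbrl).
    have -> : T (u m) - T (u n) = (y - T (u n)) - (y - T (u m)).
      by rewrite opprB [RHS]addrC addrA subrK.
    apply: le_trans (ler_normB _ _) _.
    have : (m.+1%:R^-1 : R) <= n.+1%:R^-1 by rewrite lef_pV2 ?posrE// ler_nat.
    by move: hn hm; move: (n.+1%:R^-1) (m.+1%:R^-1) => s t; lra.
  exists l; first by apply: (closed_cvg M Mcl _ l ul); apply: nearW => n; exact: (hu n).1.
  have h1 : (T \o u) @ \oo --> T l by exact: brl_cvg.
  apply: (cvg_unique (@norm_hausdorff _ W) h1).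
  apply/cvgrPdist_lt => e e0.
  move/cvgrPdist_lt: (@cvg_harmonic R) => /(_ e e0).
  apply: filterS => n; rewrite sub0r normrN ger0_norm ?invr_ge0//.
  exact/lt_trans/(hu n).2.
- by exists 0; rewrite ?(brl0 Tbrl).
- move=> _ _ p q [x Mx <-] [y My <-]; exists (x :* p + y :* q); first exact: Mlin.
  exact: Tbrl.1.
Qed.

(** Projecting first makes the inverse of the restriction total. For the frame operator and
    [range K] this is the operator [L] of the overview. *)
Definition partial_inverse := pinv M T \o orthproj (T @` M).

Lemma partial_inverseK x : M x -> partial_inverse (T x) = x.
Proof.
move=> Mx; rewrite /partial_inverse /= (orthproj_id _ _ bounded_below_closed).
  2: by exists x.
by rewrite pinvKV//; [exact: bounded_below_inj|exact: mem_set].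
Qed.

Lemma partial_inverse_spec y :
  M (partial_inverse y) /\ T (partial_inverse y) = orthproj (T @` M) y.
Proof.
have [x Mx Txy] := orthproj_in _ y bounded_below_closed.
have -> : partial_inverse y = x; last by [].
by rewrite /partial_inverse /= -Txy pinvKV//; [exact: bounded_below_inj|exact: mem_set].
Qed.

(** Linearity is checked after applying [T], which is injective on [M]; the lower bound on [T]
    becomes the upper bound. *)
Lemma partial_inverse_brl : bounded_right_linear partial_inverse.
Proof.
have [Mcl M0 Mlin] := cM; have cTM := bounded_below_closed.
split=> [x y p q|].
  have [[Mx Tx] [My Ty]] := (partial_inverse_spec x, partial_inverse_spec y).
  have [Mz Tz] := partial_inverse_spec (x :* p + y :* q).
  apply: bounded_below_inj; [exact: mem_set|exact/mem_set/Mlin|].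
  by rewrite Tz (orthproj_brl _ cTM).1 Tbrl.1 Tx Ty.
exists `|c| => x; have [Mx Tx] := partial_inverse_spec x.
apply: le_trans (T_below _ Mx) _.
apply: le_trans (ler_wpM2r (normr_ge0 _) (ler_norm c)) _.
by rewrite ler_wpM2l// Tx norm_orthproj_le.
Qed.

End bounded_below.

(** * The adjoint of an operator with closed range *)

Section closed_range.
Context {R : realType} {V : qhilbertType R} {K : V -> V}.
Hypotheses (Kbrl : bounded_right_linear K) (Kcl : closed (range K)).

Lemma closed_subspace_range : closed_subspace (range K).
Proof.
split=> //; first by exists 0; rewrite ?(brl0 Kbrl).
by move=> _ _ p q [x _ <-] [y _ <-]; exists (x :* p + y :* q); rewrite ?Kbrl.1.
Qed.

Lemma adjoint_orthproj_range x : adjoint K (orthproj (range K) x) = adjoint K x.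
Proof.
apply: (adjoint_uniq Kbrl) => z; rewrite -(adjointP Kbrl).
by rewrite orthproj_orth//; exact: closed_subspace_range.
Qed.

Lemma adjoint_bounded_below :
  exists2 C, 0 <= C & forall y, range K y -> `|y| <= C * `|adjoint K y|.
Proof.
have cR := closed_subspace_range; have Ksb := adjoint_brl Kbrl.
have [|C hC] := @weakly_bounded_bounded R V
    [set y | range K y /\ `|adjoint K y| <= 1].
  move=> z; have [x _ xz] := orthproj_in (range K) z cR.
  exists `|x| => y [Ry y1].
  rewrite -(orthproj_orth _ _ _ cR Ry) -xz -(adjointPl Kbrl).
  by apply: le_trans (qdot_CS _ _) _; rewrite ler_piMl.
(* [C] comes without a sign. A vector [y = K x] with [adjoint K y = 0] cannot be rescaled into the
   bounded set, but then [qdot y y = qdot x (adjoint K y) = 0]. *)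
exists `|C| => // y Ry; have [Ky0|Ky0] := eqVneq (`|adjoint K y|) 0.
  rewrite (_ : y = 0) ?normr0 ?mulr_ge0//.
  have [x _ xy] := Ry; apply: qdot_self_eq0.
  rewrite -{1}xy (adjointP Kbrl).
  by move/eqP: Ky0; rewrite normr_eq0 => /eqP ->; rewrite qdot0r.
have Kyp : 0 < `|adjoint K y| by rewrite lt_neqAle eq_sym Ky0 /=.
pose q := quat_real (`|adjoint K y|^-1).
have nq : `|q| = `|adjoint K y|^-1 by rewrite norm_quat_real ger0_norm ?invr_ge0.
rewrite -ler_pdivrMr// -nq -norm_rscale; apply: le_trans (ler_norm C).
apply: hC; split; first exact: closed_subspaceZ.
by rewrite (brlZ Ksb) norm_rscale nq mulfV.
Qed.

End closed_range.

(** * K-frames with closed range and their duals *)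

Section kframe.
Import summability.
#[local] Existing Instance totally_filter.
Context {R : realType} {V : qhilbertType R} {I : choiceType}.
Context {K : V -> V} {f : I -> V}.
Hypotheses (Kbrl : bounded_right_linear K) (Kcl : closed (range K)).
Hypothesis (fK : Kframe K f).

Lemma Kframe_bessel : bessel f.
Proof. by have [A [B [A0 B0 h]]] := fK; exists B => // x; case/andP: (h x). Qed.

(** On [range K], the lower frame bound gives [A * |K^* y| ^+ 2 <= qre (qdot (S y) y) <= |S y| *
    |y|], and [|y| <= C * |K^* y|]; together these give the constant [C ^+ 2 / A]. *)
Lemma frame_op_bounded_below :
  exists c, forall y, range K y -> `|y| <= c * `|frame_op f y|.
Proof.
have [C C0 hC] := adjoint_bounded_below Kbrl Kcl.
have [A [B [A0 B0 h]]] := fK.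
exists (C ^+ 2 / A) => y Ry.
have [->|y0] := eqVneq y 0.
  by rewrite (brl0 (frame_op_brl f Kframe_bessel)) !normr0 mulr0.
have yp : 0 < `|y| by rewrite normr_gt0.
have lowA : A * `|adjoint K y| ^+ 2 <= `|frame_op f y| * `|y|.
  have /andP[+ _] := h y; rewrite (sqr_coefs_analysis f Kframe_bessel) lee_fin.
  move=> /le_trans; apply; rewrite sqr_norm_qdot -qdot_frame_op.
  exact: qre_qdot_le.
rewrite mulrAC ler_pdivlMr// -(ler_pM2r yp) mulrAC mulrC -expr2 -mulrA.
have yC : `|y| ^+ 2 <= C ^+ 2 * `|adjoint K y| ^+ 2.
  by rewrite -exprMn ler_pXn2r ?nnegrE ?mulr_ge0// hC.
apply: le_trans (ler_wpM2l (ltW A0) yC) _.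
by rewrite mulrCA ler_wpM2l ?exprn_ge0.
Qed.

Lemma sqr_coefs_orthproj x :
  sqr_coefs (fun k => orthproj (range K) (f k)) x =
  sqr_coefs f (orthproj (range K) x).
Proof.
have cR := closed_subspace_range Kbrl Kcl.
by apply: eq_esum => k _; rewrite orthproj_self_adjoint.
Qed.

(** The bounds [A] and [B] are kept: the inequalities for [f] are used at the projection of [x],
    which [K^*] does not distinguish from [x] and whose norm is at most [|x|]. *)
Lemma Kframe_orthproj : Kframe K (fun k => orthproj (range K) (f k)).
Proof.
have cR := closed_subspace_range Kbrl Kcl.
have [A [B [A0 B0 h]]] := fK; exists A, B; split=> // x.
rewrite sqr_coefs_orthproj; have /andP[h1 h2] := h (orthproj (range K) x).
rewrite -(adjoint_orthproj_range Kbrl Kcl) h1 /=; apply: le_trans h2 _.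
by rewrite lee_fin ler_wpM2l ?(ltW B0)// ler_pXn2r ?nnegrE// norm_orthproj_le.
Qed.

Lemma orthproj_synthesis_cvg (c : l2 R I) :
  (partial_sum (fun k => orthproj (range K) (f k) :* c k) @ totally) -->
  orthproj (range K) (synthesis f c).
Proof.
have Pb := orthproj_brl _ (closed_subspace_range Kbrl Kcl).
have [C C0 PC] := brl_bound Pb.
have := cvg_usum_map (brlD Pb) PC (synthesis_cvg f Kframe_bessel c).
rewrite -synthesisE (_ : _ \o _ = fun k => orthproj (range K) (f k) :* c k)//.
by apply/funext => k; rewrite /= (brlZ Pb).
Qed.

Local Notation L := (@partial_inverse R V V (frame_op f) (range K)).

(** Since [qdot (N^* e_k) x] is the coordinate [N x k], the reconstruction series converges to
    [P T N x]. Uniqueness of limits then turns duality into the operator equation [P T N = K]. *)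
Lemma Kdual_adjoint_basis (N : V -> l2 R I) : bounded_right_linear N ->
  Kdual K (fun k => orthproj (range K) (f k)) (fun k => adjoint N (l2_basis k))
  <-> forall x, orthproj (range K) (synthesis f (N x)) = K x.
Proof.
move=> Nb.
have NE x : (fun k => orthproj (range K) (f k) :* qdot (adjoint N (l2_basis k)) x) =
    (fun k => orthproj (range K) (f k) :* N x k).
  by apply/funext => k; rewrite (adjointPl Nb) qdot_l2_basis.
split=> [[_ _ h] x|h].
  have hx := h x; rewrite NE in hx.
  exact: (cvg_unique (@norm_hausdorff _ V) (orthproj_synthesis_cvg (N x)) hx).
split; [exact: Kframe_orthproj|exact: bessel_adjoint_basis|move=> x].
by rewrite NE -h; exact: orthproj_synthesis_cvg.
Qed.

Definition canonical_coefs : V -> l2 R I :=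
  analysis f Kframe_bessel \o (adjoint L \o K).

Lemma partial_inverse_frame_op_brl : bounded_right_linear L.
Proof.
have [c hc] := frame_op_bounded_below.
exact: partial_inverse_brl (frame_op_brl f Kframe_bessel)
  (closed_subspace_range Kbrl Kcl) hc.
Qed.

Lemma canonical_coefs_brl : bounded_right_linear canonical_coefs.
Proof.
apply: brl_comp; first exact: analysis_brl.
apply: brl_comp => //; exact: adjoint_brl partial_inverse_frame_op_brl.
Qed.

(** The adjoint of [T^* L^* K] is [K^* L T], and [T] sends [l2_basis k] to [f k]. *)
Lemma adjoint_canonical_coefs k :
  adjoint canonical_coefs (l2_basis k) = adjoint K (L (f k)).
Proof.
apply: (adjoint_uniq canonical_coefs_brl) => x.
rewrite /canonical_coefs /= (adjointP (analysis_brl _ _)) adjoint_analysis_basis.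
by rewrite (adjointPl partial_inverse_frame_op_brl) (adjointP Kbrl).
Qed.

(* S and P are self-adjoint, so [P S L^* P] is the adjoint of [P L S P], and
   [L S P = P]. *)
Lemma synthesis_canonical_coefs x :
  orthproj (range K) (synthesis f (canonical_coefs x)) = K x.
Proof.
have cR := closed_subspace_range Kbrl Kcl; pose bf := Kframe_bessel.
have [c hc] := frame_op_bounded_below.
have -> : synthesis f (canonical_coefs x) = frame_op f (adjoint L (K x)).
  rewrite /canonical_coefs /frame_op (adjoint_synthesis f bf); reflexivity.
(* Tested against [z] in [range K]: moving [S] and then [L^*] to the left side leaves [L (S z)],
   which is [z]. *)
apply: orthproj_uniq => // z Rz; rewrite -frame_op_self_adjoint//.
rewrite -(adjointP partial_inverse_frame_op_brl).
by rewrite (partial_inverseK (frame_op_brl f bf) cR hc).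
Qed.

End kframe.

Theorem theorem3p7 (R : realType) (H : qhilbertType R) (I : countType)
    (K : H -> H) (f : I -> H) :
  separable H ->
  bounded_right_linear K ->
  closed (range K) ->
  Kframe K f ->
  forall g : I -> H,
    Kdual K (fun k => orthproj (range K) (f k)) g <->
    exists M : H -> l2 R I,
      [/\ bounded_right_linear M,
          forall x, orthproj (range K) (synthesis f (M x)) = 0 &
          forall k, g k =
            adjoint K (pinv (range K) (frame_op f)
              (orthproj (frame_op f @` range K) (f k))) +
            adjoint M (l2_basis k)].
Proof.
move=> _ Kb Kcl fK g.
have bf := Kframe_bessel fK; have Tb := synthesis_brl f bf.
have Pb := orthproj_brl _ (closed_subspace_range Kb Kcl).
pose N0 := canonical_coefs fK.
have N0b : bounded_right_linear N0 := canonical_coefs_brl Kb Kcl fK.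
have N0K x : orthproj (range K) (synthesis f (N0 x)) = K x.
  exact: synthesis_canonical_coefs.
have N0e k : adjoint N0 (l2_basis k) = adjoint K (pinv (range K) (frame_op f)
    (orthproj (frame_op f @` range K) (f k))) by exact: adjoint_canonical_coefs.
split=> [gK|[M [Mb PTM gE]]].
  have [_ bg _] := gK; pose N := analysis g bg.
  have Nb : bounded_right_linear N := analysis_brl g bg.
  have gN : g = fun k => adjoint N (l2_basis k).
    by apply/funext => k; rewrite adjoint_analysis_basis.
  have /(Kdual_adjoint_basis Kb Kcl fK _ Nb) NK :
    Kdual K (fun k => orthproj (range K) (f k)) (fun k => adjoint N (l2_basis k)).
    by rewrite -gN.
  (* Both [N] and [N0] solve [P T N = K], so [P T] annihilates their difference. *)
  exists (fun x => N x - N0 x); split=> [|x|k]; first exact: brl_sub.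
    by rewrite (brlB Tb) (brlB Pb) NK N0K subrr.
  rewrite -N0e gN; apply: qdot_ext => x.
  have Sb := brl_sub _ _ _ _ Nb N0b.
  by rewrite qdotDr -(adjointP Nb) -(adjointP N0b) -(adjointP Sb) qdotBl addrC subrK.
(* The sum [N0 + M] is written as a difference so that [brl_sub] applies. *)
have Nb : bounded_right_linear (fun x => N0 x - (- M x)).
  apply: brl_sub => //; split=> [x y p q|].
    by rewrite Mb.1 opprD !rscaleNl.
  by have [C C0 MC] := brl_bound Mb; exists C => x; rewrite normrN.
have -> : g = fun k => adjoint (fun x => N0 x - (- M x)) (l2_basis k).
  apply/funext => k; rewrite gE -N0e; apply: qdot_ext => x.
  by rewrite -(adjointP Nb) qdotDr -(adjointP Mb) -(adjointP N0b) opprK qdotDl.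
apply/(Kdual_adjoint_basis Kb Kcl fK _ Nb) => x.
by rewrite opprK (brlD Tb) (brlD Pb) N0K PTM addr0.
Qed.
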